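(* Let $f$ be a field of characteristic $0$, $0\ne\lambda\in f$, let $m\ge0$, $k\ge1$ be integers, and let $P_{mk}^{(-1/\lambda)}$ be defined by $$\sum_{k=1}^{\infty}P_{mk}^{(-1/\lambda)}(x_0,x_1,\dots,x_{m+k})z^k=\frac{\left(\sum_{i=0}^{\infty}x_ix_0^{i-1}z^i\right)^{-1/\lambda}-\left(\sum_{i=0}^{m}x_ix_0^{i-1}z^i\right)^{-1/\lambda}}{x_0^mz^m}.$$ Then: (1) $P_{mk}^{(-1/\lambda)}$ is homogeneous of degree $k$ and isobaric of weight $m+k$ (where $x_i$ has weight $i$). (2) $$P_{mk}^{(-1/\lambda)}(x_0,\dots,x_{m+k})=\sum_{\substack{\pi\vdash m+k\\ \pi_1>m}}\binom{-1/\lambda}{p_1,\dots,p_{m+k}}x_0^{p_0}x_1^{p_1}\cdots x_{m+k}^{p_{m+k}},$$ where $\pi=(1^{p_1}2^{p_2}\dots)$ runs over partitions of $m+k$ with largest part $\pi_1>m$, and $p_0=k-\ell(\pi)$, $\ell(\pi)$ being the length of $\pi$. (3) With $x=(x_{m+1},\dots,x_{m+k})$, $dx=(dx_{m+1},\dots,dx_{m+k})$, $$P_{mk}^{(-1/\lambda)}(x_0,\dots,x_{m+k})=\frac{1}{(k-1)!(-\lambda)^k}\int_0^x\det\binom{dx}{A},$$ where $A$ is the $(k-1)\times k$ matrix $$A=\begin{pmatrix}(k-1)\lambda x_0&((k-1)\lambda+1)x_1&\dots&((k-1)\lambda+(k-2))x_{k-2}&(k-1)(\lambda+1)x_{k-1}\\0&(k-2)\lambda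 x_0&\dots&((k-2)\lambda+(k-3))x_{k-3}&(k-2)(\lambda+1)x_{k-2}\\ \vdots&&&&\vdots\\0&0&\dots&\lambda x_0&(\lambda+1)x_1\end{pmatrix}.$$ (4) $P_{0k}^{(-1/\lambda)}(x_0,\dots,x_k)=\frac1{k!(-\lambda)^k}\det\binom{x'}{A}$ with $x'=(x_1,2x_2,\dots,kx_k)$. (5) If $m\ge k-1$, then $P_{mk}^{(-1/\lambda)}(x_0,\dots,x_{m+k})=\frac1{(k-1)!(-\lambda)^k}\det\binom{x}{A}$ with $x=(x_{m+1},\dots,x_{m+k})$. (6) $P_{m1}^{(-1/\lambda)}=-\frac1\lambda x_{m+1}$; $P_{02}^{(-1/\lambda)}=-\frac1\lambda x_0x_2+\frac{\lambda+1}{2\lambda^2}x_1^2$; $P_{m2}^{(-1/\lambda)}=-\frac1\lambda x_0x_{m+2}+\frac{\lambda+1}{\lambda^2}x_1x_{m+1}$ for $m\ge1$; $P_{03}^{(-1/\lambda)}=-\frac1\lambda x_0^2x_3+\frac{\lambda+1}{\lambda^2}x_0x_1x_2-\frac{(\lambda+1)(2\lambda+1)}{6\lambda^3}x_1^3$; $P_{13}^{(-1/\lambda)}=-\frac1\lambda x_0^2x_4+\frac{\lambda+1}{2\lambda^2}x_0(2x_1x_3+x_2^2)-\frac{(\lambda+1)(2\lambda+1)}{2\lambda^3}x_1^2x_2$; $P_{m3}^{(-1/\lambda)}=-\frac1\lambda x_0^2x_{m+3}+\frac{\lambda+1}{\lambda^2}x_0(x_1x_{m+2}+x_2x_{m+1})-\frac{(\lambda+1)(2\lambda+1)}{2\lambda^3}x_1^2x_{m+1}$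 for $m\ge2$; $P_{04}^{(-1/\lambda)}=-\frac1\lambda x_0^3x_4+\frac{\lambda+1}{2\lambda^2}x_0^2(2x_1x_3+x_2^2)-\frac{(\lambda+1)(2\lambda+1)}{2\lambda^3}x_0x_1^2x_2+\frac{(\lambda+1)(2\lambda+1)(3\lambda+1)}{24\lambda^4}x_1^4$; $P_{14}^{(-1/\lambda)}=-\frac1\lambda x_0^3x_5+\frac{\lambda+1}{\lambda^2}x_0^2(x_1x_4+x_2x_3)-\frac{(\lambda+1)(2\lambda+1)}{2\lambda^3}x_0(x_1^2x_3+x_1x_2^2)+\frac{(\lambda+1)(2\lambda+1)(3\lambda+1)}{6\lambda^4}x_1^3x_2$; $P_{24}^{(-1/\lambda)}=-\frac1\lambda x_0^3x_6+\frac{\lambda+1}{2\lambda^2}x_0^2(2x_1x_5+2x_2x_4+x_3^2)-\frac{(\lambda+1)(2\lambda+1)}{2\lambda^3}x_0(x_1^2x_4+2x_1x_2x_3)+\frac{(\lambda+1)(2\lambda+1)(3\lambda+1)}{6\lambda^4}x_1^3x_3$; $P_{m4}^{(-1/\lambda)}=-\frac1\lambda x_0^3x_{m+4}+\frac{\lambda+1}{\lambda^2}x_0^2(x_1x_{m+3}+x_2x_{m+2}+x_3x_{m+1})-\frac{(\lambda+1)(2\lambda+1)}{2\lambda^3}x_0(x_1^2x_{m+2}+2x_1x_2x_{m+1})+\frac{(\lambda+1)(2\lambda+1)(3\lambda+1)}{6\lambda^4}x_1^3x_{m+1}$ for $m\ge3$. (7) $P_{0k}^{(-1/\lambda)}(1,1,\dots,1)=(-1)^k\binom{1/\lambda}{k}$,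 and $P_{mk}^{(-1/\lambda)}(1,1,\dots,1)=\frac{(-1)^k}{\lambda}\binom{1/\lambda}{k-1}$ for $m\ge k-1$. (8) If $-1/\lambda\ne n$ for every positive integer $n<k$, the sum in (2) has $p(k)$ nonzero terms for $m=0$, and $p(0)+p(1)+\dots+p(k-1)$ nonzero terms for $m\ge k-1$. If $-1/\lambda=n$ for a positive integer $n<k$, the sum in (2) has $p_n(k)$ nonzero terms for $m=0$, and $p_n(0)+p_n(1)+\dots+p_n(k-1)$ nonzero terms for $m\ge k-1$. Here $p(k)$ is the number of partitions of $k$ and $p_n(k)$ is the number of partitions of $k$ of length $\le n$.
   Context: In the generating function the series have constant term $1$ in $z$ (as $x_0x_0^{-1}=1$) and powers are given by the binomial series. For $a\in f$ and nonnegative integers $p_1,\dots,p_r$ with $\ell=p_1+\dots+p_r$, $\binom{a}{p_1,\dots,p_r}=\frac{a(a-1)\cdots(a-\ell+1)}{p_1!\cdots p_r!}$, and $\binom{a}{j}=\frac{a(a-1)\cdots(a-j+1)}{j!}$. $\binom{v}{A}$, for a row vector $v$ of length $k$, denotes the $k\times k$ matrix obtained by adding the row $v$ on top of $A$; for $k=1$, $A$ is empty. Row $r$ of $A$ ($1\le r\le k-1$) has, in column $c\ge r$, the entry $((k-r)\lambda+(c-r))x_{c-r}$, and $0$ in columns $c<r$. In (3), $x_0,\dots,x_m$ are treated as constants, $\det\binom{dx}{A}$ is a polynomial differential 1-form in $x_{m+1},\dots,x_{m+k}$, and $\int_0^x$ denotes its line integral from $0$ to $x$, i.e. the polynomial in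 $x_{m+1},\dots,x_{m+k}$ vanishing at $x_{m+1}=\dots=x_{m+k}=0$ whose differential is this form.
   Formalization: In (8), for -1/λ = n with 0<n<k and m ≥ k-1, the number of nonzero terms is proved to be p_{n-1}(0)+…+p_{n-1}(k-1); the printed p_n(0)+…+p_n(k-1) is always too large (k=2, n=1, m=1: one nonzero term, printed value 2). *)

(* Defs.v *)
From HB Require Import structures.
From mathcomp Require Import all_boot all_order all_algebra.
From mathcomp Require Import mpoly.
From mathcomp Require monalg.

Set Implicit Arguments.
Unset Strict Implicit.
Unset Printing Implicit Defensive.

Import GRing.Theory.
Local Open Scope ring_scope.

(* f[x_0, x_1, x_2, ...], the polynomials in countably many indeterminates.
   The import is kept local because monalg and mpoly share notations and
   names. *)
Module InfPoly.
Import monalg.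

Definition ring (f : fieldType) : comAlgType f := {malg f[{cmonom nat}]}.

Definition var (f : fieldType) (i : nat) : ring f := mkmalgU (ucm i) 1.

End InfPoly.

Definition falling (f : fieldType) (a : f) (l : nat) : f :=
  \prod_(i < l) (a - i%:R).

Definition gbinom (f : fieldType) (a : f) (j : nat) : f :=
  falling a j / j`!%:R.

(* A formal power series sum_n u_n z^n is the function n |-> u_n. *)
Section Series.
Variables (f : fieldType) (R : comAlgType f).
Implicit Types u v : nat -> R.

Definition fps_one : nat -> R := fun n => (n == 0%N)%:R.

Definition fps_mul u v : nat -> R :=
  fun n => \sum_(i < n.+1) u i * v (n - i)%N.

Definition fps_exp u (j : nat) : nat -> R := iter j (fps_mul u) fps_one.

(* u^a = sum_j binom(a,j) (u - 1)^j for u with constant term 1: then (u - 1)^j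
   has no coefficient in degree n < j, so the sum over j <= n is complete. *)
Definition fps_pow (a : f) u : nat -> R :=
  fun n => \sum_(j < n.+1) gbinom a j *: fps_exp (u \- fps_one) j n.

Definition fps_trunc (m : nat) u : nat -> R :=
  fun i => if (i <= m)%N then u i else 0.

Definition fps_mono (c : R) (m : nat) : nat -> R :=
  fun i => if i == m then c else 0.

End Series.

(* sum_i x_i x_0^(i-1) z^i, whose coefficient at i = 0 is x_0 x_0^-1 = 1. *)
Definition xseries (f : fieldType) : nat -> InfPoly.ring f :=
  fun i => if i is j.+1 then InfPoly.var f i * InfPoly.var f 0 ^+ j else 1.

Definition inf_embed (f : fieldType) (n : nat) (p : {mpoly f[n]}) :
    InfPoly.ring f :=
  mmap (GRing.in_alg (InfPoly.ring f)) (fun i : 'I_n => InfPoly.var f i) p.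

(* The polynomial P m k is in the indeterminates x_0, ..., x_(m+k).  The
   quotient by x_0^m z^m defining sum_(k >= 1) (P m k) z^k is expressed by
   multiplying out in f[x_0, x_1, ...][[z]], where x_0^m z^m is not a zero
   divisor.  P m 0 is not constrained. *)
Definition generated (f : fieldType) (lam : f)
    (P : forall m k : nat, {mpoly f[(m + k).+1]}) : Prop :=
  forall m : nat,
    fps_mul (fps_mono (InfPoly.var f 0 ^+ m) m)
            (fun k => if k == 0%N then 0 else inf_embed (P m k))
    =1 fps_pow (-1 / lam) (@xseries f)
         \- fps_pow (-1 / lam) (fps_trunc m (@xseries f)).

(* The indeterminate x_i; meaningful for i <= n only. *)
Definition xv (f : fieldType) (n i : nat) : {mpoly f[n.+1]} := 'X_(inord i).
Arguments xv {f n} i.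

(* The weight in which x_i counts i (mnmwgt of mpoly counts it i + 1). *)
Definition wgt (n : nat) (e : 'X_{1..n}) : nat := (\sum_(i < n) i * e i)%N.

Lemma wgt0 n : wgt (0%MM : 'X_{1..n}) = 0%N.
Proof. by rewrite /wgt big1 // => i _; rewrite mnm0E muln0. Qed.

Lemma wgtD n : {morph @wgt n : e1 e2 / (e1 + e2)%MM >-> (e1 + e2)%N}.
Proof.
move=> e1 e2; rewrite /wgt -big_split /=.
by apply: eq_bigr => i _; rewrite mnmDE mulnDr.
Qed.

HB.instance Definition _ n := isMeasure.Build n (@wgt n) (@wgt0 n) (@wgtD n).

(* The partition (1^p_1 2^p_2 ... n^p_n) of n is coded by its multiplicities;
   the index i : 'I_n stands for the part i + 1. *)
Definition partitions (n : nat) : {set {ffun 'I_n -> 'I_n.+1}} :=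
  [set p : {ffun 'I_n -> 'I_n.+1} | \sum_(i < n) i.+1 * p i == n]%N.

Definition plength (n : nat) (p : {ffun 'I_n -> 'I_n.+1}) : nat :=
  (\sum_(i < n) p i)%N.

Definition plargest (n : nat) (p : {ffun 'I_n -> 'I_n.+1}) : nat :=
  (\max_(i < n | 0 < p i) i.+1)%N.

Definition npart (k : nat) : nat := #|partitions k|.

Definition npart_le (n k : nat) : nat :=
  #|[set p in partitions k | plength p <= n]%N|.

Definition gmultinom (f : fieldType) (a : f) (n : nat)
    (p : {ffun 'I_n -> 'I_n.+1}) : f :=
  falling a (plength p) / \prod_(i < n) (p i)`!%:R.

(* When plargest p > m, the length of p is at most k, so that the exponent
   p_0 = k - plength p is not truncated. *)
Definition pterm (f : fieldType) (lam : f) (m k : nat)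
    (p : {ffun 'I_(m + k) -> 'I_(m + k).+1}) : {mpoly f[(m + k).+1]} :=
  gmultinom (-1 / lam) p
    *: (xv 0 ^+ (k - plength p) * \prod_(i < m + k) xv i.+1 ^+ p i).

Definition pindex (m k : nat) : {set {ffun 'I_(m + k) -> 'I_(m + k).+1}} :=
  [set p in partitions (m + k) | m < plargest p]%N.

(* The k x k matrix with the row v on top of A; only k >= 1 is meaningful. *)
Definition binom_mx (R : comNzRingType) (k : nat) :
    'rV[R]_k -> 'M[R]_(k.-1, k) -> 'M[R]_k :=
  if k is _.+1 then fun v A => col_mx v A else fun _ _ => 0.

(* Rows and columns are numbered from 0, so (r, c) is the position
   (r + 1, c + 1) of the usual numbering. *)
Definition Amx (f : fieldType) (n : nat) (lam : f) (k : nat) :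
    'M[{mpoly f[n.+1]}]_(k.-1, k) :=
  \matrix_(r, c) if (r <= c)%N
                 then ((k - r.+1)%:R * lam + (c - r)%:R) *: xv (c - r)
                 else 0.
Arguments Amx {f n} lam k.

(* Polynomial differential forms in x_(m+1), ..., x_(m+k) are elements of
   f[x_0, ..., x_(m+k)][dx_(m+1), ..., dx_(m+k)], the 1-forms being those that
   are homogeneous of degree 1; the indeterminate 'X_c, c : 'I_k, is
   dx_(m+c+1). *)
Section Forms.
Variables (f : fieldType) (m k : nat).
Implicit Type Q : {mpoly f[(m + k).+1]}.

Definition form := {mpoly {mpoly f[(m + k).+1]}[k]}.

Definition differential Q : form :=
  \sum_(c < k) (mderiv (inord (m + c.+1)) Q)%:MP * 'X_c.

Definition det_dx_A (lam : f) : form :=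
  \det (binom_mx (\row_(c < k) 'X_c)
                 (map_mx (@mpolyC k {mpoly f[(m + k).+1]}) (Amx lam k))).

Definition at_origin Q : {mpoly f[(m + k).+1]} :=
  mmap (@mpolyC (m + k).+1 f)
       (fun i : 'I_(m + k).+1 => if (i <= m)%N then 'X_i else 0) Q.

(* Q is the integral of w from 0 to x. *)
Definition is_line_integral (w : form) Q : Prop :=
  differential Q = w /\ at_origin Q = 0.

End Forms.

(* Main.v *)
Require Import Defs.
From HB Require Import structures.
From mathcomp Require Import all_boot all_order all_algebra.
From mathcomp Require Import mpoly.
From mathcomp Require Import ring zify.
From mathcomp Require monalg finmap.

Set Implicit Arguments.
Unset Strict Implicit.
Unset Printing Implicit Defensive.

Import GRing.Theory.
Local Open Scope ring_scope.

(** Let [a = -1/lam], let [u = sum_i x_i x_0^(i-1) z^i], let [T] be the part of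
    [u] of degree at most [m] and let [b = u^(a-1)].  The defining identity says
    that [x_0^m P_mk] is the coefficient of [z^(m+k)] in [u^a - T^a].

    Partitions.  By the multinomial theorem the coefficient of [z^n] in [u^a]
    is a sum over the partitions of [n] ([fps_pow_partitions]), and passing to
    [T] keeps exactly the partitions without a part larger than [m].  A
    partition of [m+k] with a part larger than [m] has length at most [k], so
    its term is divisible by [x_0^m] ([pow_sub_trunc]): this gives existence,
    uniqueness, the partition formula and the degree and weight.  The term of a
    partition of length [l] vanishes exactly when [a(a-1)...(a-l+1)] does, and
    for [m >= k-1] removing the largest part is a bijection from the partitions
    in the formula to the partitions of [0], ..., [k-1] that lowers the length
    by one; the numbers of nonzero terms follow.

    Determinants.  From [u . z b' = (a-1) . z u' . b] one reads off that the
    column [w] with entries [w_c = x_0^c b_(k-1-c)], [0 <= c < k], is killed by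
    [A].  Hence the determinant of [A] under a row [v] is
    [(k-1)! (-lam)^(k-1) sum_c v_c w_c] for every [v] ([det_recurrence]), and
    the determinant formulas only say that [P_mk] is built from the [w_c].  For
    the line integral, the chain rule gives [dP_mk / dx_(m+c+1) = a w_c].  For
    [m = 0], use [z (u^a)' = a . z u' . b].  For [m >= k-1], the series [u - T]
    starts in degree [m+1], so that its square does not reach degree
    [m+k <= 2m+1] and [u^a - T^a] may be replaced by [a (u - T) b].

    At the point where all [x_i] are 1, the recurrence for [v = u^a] becomes
    [(n+1) v_(n+1) = (n+a) v_n], that of the coefficients of [(1-z)^(-a)].  The
    explicit polynomials for [k <= 4] come from expanding the coefficients of
    [u^a] up to degree 6. *)

(** * Power series as truncated polynomials *)

Section Coefficients.
Variables (f : fieldType) (R : comAlgType f).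
Implicit Types (u v w : nat -> R) (a : f).

Definition trunc_poly (N : nat) u : {poly R} := \poly_(i < N.+1) u i.

Lemma coef_trunc_poly N u i : (i <= N)%N -> (trunc_poly N u)`_i = u i.
Proof. by move=> le_iN; rewrite coef_poly ltnS le_iN. Qed.

(** Formal series are handled through polynomials that agree with them up to
    a degree [N]: the ring laws, powers and derivations of polynomials are then
    available, and this lemma transports their products back. *)
Lemma fps_mul_coef N u v (p q : {poly R}) n :
  (forall i, (i <= N)%N -> p`_i = u i) -> (forall i, (i <= N)%N -> q`_i = v i) ->
  (n <= N)%N -> (p * q)`_n = fps_mul u v n.
Proof.
move=> pE qE le_nN; rewrite coefM /fps_mul; apply: eq_bigr => i _.
by rewrite pE ?qE //; have := ltn_ord i; lia.
Qed.

Lemma fps_mulC u v n : fps_mul u v n = fps_mul v u n.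
Proof.
rewrite -(fps_mul_coef (@coef_trunc_poly n u) (@coef_trunc_poly n v)) //.
by rewrite mulrC; apply: (@fps_mul_coef n) => // i; apply: coef_trunc_poly.
Qed.

Lemma fps_mulA u v w n :
  fps_mul u (fps_mul v w) n = fps_mul (fps_mul u v) w n.
Proof.
rewrite -(@fps_mul_coef n _ _ (trunc_poly n u) (trunc_poly n v * trunc_poly n w)) //.
- rewrite mulrA; apply: fps_mul_coef (leqnn n); last exact: coef_trunc_poly.
  move=> i le_in; apply: (@fps_mul_coef n) => // j; exact: coef_trunc_poly.
- exact: coef_trunc_poly.
- move=> i le_in; apply: (@fps_mul_coef n) => // j; exact: coef_trunc_poly.
Qed.

Lemma fps_mulZl a u v n : fps_mul (a \*: u) v n = a *: fps_mul u v n.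
Proof. by rewrite scaler_sumr; apply: eq_bigr => i _; rewrite scalerAl. Qed.

Lemma eq_fps_mul u u' v v' n :
  (forall i, (i <= n)%N -> u i = u' i) -> (forall i, (i <= n)%N -> v i = v' i) ->
  fps_mul u v n = fps_mul u' v' n.
Proof.
move=> eu ev; apply: eq_bigr => i _.
by rewrite eu ?ev //; have := ltn_ord i; lia.
Qed.

Lemma fps_exp_coef N u (p : {poly R}) j n :
  (forall i, (i <= N)%N -> p`_i = u i) -> (n <= N)%N -> (p ^+ j)`_n = fps_exp u j n.
Proof.
move=> pE; elim: j n => [|j IHj] n le_nN; first by rewrite expr0 coef1.
by rewrite exprS; apply: fps_mul_coef le_nN.
Qed.

Lemma coef_exp_lt (p : {poly R}) j n : p`_0 = 0 -> (n < j)%N -> (p ^+ j)`_n = 0.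
Proof.
move=> p0 lt_nj.
have -> : p = 'X * \poly_(i < size p) p`_i.+1.
  apply/polyP=> -[|i]; rewrite coefXM //= coef_poly.
  by case: ltnP => // /leqW /(nth_default _) ->.
by rewrite exprMn mulrC coefMXn lt_nj.
Qed.

(** The binomial series of [(1 + p)^a] cut after [p^M].  The scalars are mapped
    to [R] because the polynomials form an algebra over [R] only. *)
Definition binomial_poly a (M : nat) (p : {poly R}) : {poly R} :=
  \sum_(j < M.+1) (gbinom a j)%:A *: p ^+ j.

(** Since [p] has no constant term, [p^j] with [j > n] does not reach degree
    [n]; so the cut at [M] is
    invisible in degree [n <= M]. *)
Lemma fps_pow_coef a u (p : {poly R}) M N n :
  u 0 = 1 -> (forall i, (i <= N)%N -> p`_i = (u \- fps_one R) i) ->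
  (n <= M)%N -> (n <= N)%N -> (binomial_poly a M p)`_n = fps_pow a u n.
Proof.
move=> u0 pE le_nM le_nN.
have p0 : p`_0 = 0 by rewrite pE //= u0 /fps_one eqxx subrr.
rewrite coef_sum /fps_pow.
rewrite -(big_mkord xpredT (fun j => ((gbinom a j)%:A *: p ^+ j)`_n)).
rewrite (@big_cat_nat _ _ _ n.+1) //= big_mkord [X in _ + X]big1_seq ?addr0.
  by apply: eq_bigr => j _; rewrite coefZ mulr_algl (fps_exp_coef _ pE).
move=> j; rewrite mem_index_iota => /andP[_ /andP[lt_nj _]].
by rewrite coefZ (coef_exp_lt p0) ?mulr0.
Qed.

End Coefficients.

(** * Generalised binomial coefficients and the rules of differentiation *)

Section GeneralBinomial.
Variables (f : fieldType) (char0 : [pchar f] =i pred0).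
Implicit Type a : f.

Lemma natr_eq0 n : (n%:R == 0 :> f) = (n == 0)%N.
Proof. by move/pcharf0P: char0 => ->. Qed.

Lemma fact_neq0 n : n`!%:R != 0 :> f.
Proof. by rewrite natr_eq0 -lt0n fact_gt0. Qed.

Lemma falling0 a : falling a 0 = 1.
Proof. by rewrite /falling big_ord0. Qed.

Lemma fallingS a l : falling a l.+1 = falling a l * (a - l%:R).
Proof. by rewrite /falling big_ord_recr. Qed.

Lemma fallingSl a l : falling a l.+1 = a * falling (a - 1) l.
Proof.
rewrite /falling big_ord_recl subr0; congr (_ * _); apply: eq_bigr => i _.
by rewrite lift0 -natr1; ring.
Qed.

Lemma gbinom0 a : gbinom a 0 = 1.
Proof. by rewrite /gbinom falling0 divr1. Qed.

Lemma gbinom_fact a j : gbinom a j * j`!%:R = falling a j.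
Proof. by rewrite /gbinom divfK ?fact_neq0. Qed.

Lemma gbinomS a j : gbinom a j.+1 = (a - j%:R) / j.+1%:R * gbinom a j.
Proof.
rewrite /gbinom fallingS factS natrM; field.
by rewrite fact_neq0 addrC natr1 natr_eq0.
Qed.

(** The coefficients of the derivative of the binomial series. *)
Lemma gbinomSl a j : j.+1%:R * gbinom a j.+1 = a * gbinom (a - 1) j.
Proof.
rewrite /gbinom fallingSl factS natrM; field.
by rewrite fact_neq0 addrC natr1 natr_eq0.
Qed.

Lemma gbinom_pascal a j : gbinom a j.+1 = gbinom (a - 1) j.+1 + gbinom (a - 1) j.
Proof.
rewrite /gbinom fallingSl fallingS factS natrM; field.
by rewrite fact_neq0 addrC natr1 natr_eq0.
Qed.

End GeneralBinomial.

Section PowerRules.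
Variables (f : fieldType) (char0 : [pchar f] =i pred0) (R : comAlgType f).
Implicit Types (u : nat -> R) (a : f).

(** The rule [(u^a)' = a u' u^(a-1)] for an arbitrary derivation: it is used
    both for differentiation in the series variable and for derivations of the
    coefficient ring.  Since [(p^j)' = j p' p^(j-1)], lowering the cut from
    [M+1] to [M] makes the identity exact. *)
Lemma binomial_poly_chain a M (p : {poly R})
    (dlt : {additive {poly R} -> {poly R}}) :
  (forall q r, dlt (q * r) = dlt q * r + q * dlt r) ->
  (forall (c : f) q, dlt (c%:A *: q) = c%:A *: dlt q) ->
  dlt (binomial_poly a M.+1 p) = a%:A *: (dlt p * binomial_poly (a - 1) M p).
Proof.
move=> dltM dltZ.
have dlt1 : dlt 1 = 0.
  by apply: (addrI (dlt 1)); rewrite addr0 -{3}[1]mulr1 dltM mulr1 mul1r.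
have dltX j : dlt (p ^+ j.+1) = j.+1%:R *: (dlt p * p ^+ j).
  elim: j => [|j IHj]; first by rewrite expr1 mulr1 scale1r.
  rewrite exprS dltM IHj -scalerAr [p * _]mulrCA -exprS -[X in X + _]scale1r.
  by rewrite -scalerDl -[in RHS]natr1 addrC.
rewrite /binomial_poly big_ord_recl /= raddfD dltZ expr0 dlt1 scaler0 add0r.
rewrite raddf_sum mulr_sumr scaler_sumr; apply: eq_bigr => j _.
rewrite dltZ dltX -scalerAr !scalerA; congr (_ *: _).
by rewrite mulr_natr scalerMnl -mulr_natl (gbinomSl char0) -scalerAl mul1r scalerA.
Qed.

(** The chain rule for a derivation [D] acting on coefficients; it will be
    [d/dx_(m+c+1)]. *)
Lemma fps_pow_chain a u (D : {additive R -> R}) n :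
  (forall q r, D (q * r) = D q * r + q * D r) ->
  (forall c : f, D c%:A = 0) -> u 0 = 1 ->
  D (fps_pow a u n) = a *: fps_mul (D \o u) (fps_pow (a - 1) u) n.
Proof.
move=> DM DA u0.
set p := trunc_poly n (u \- fps_one R).
have pE i : (i <= n)%N -> p`_i = (u \- fps_one R) i by exact: coef_trunc_poly.
have chain : map_poly D (binomial_poly a n.+1 p) =
    a%:A *: (map_poly D p * binomial_poly (a - 1) n p).
  apply: (@binomial_poly_chain a n p (map_poly D)) => [q r|c q].
    apply/polyP=> i; rewrite !(coefD, coefM, coef_map) raddf_sum -big_split /=.
    by apply: eq_bigr => j _; rewrite DM !coef_map.
  by apply/polyP=> i; rewrite !(coefZ, coef_map) DM DA mul0r add0r.
rewrite -(fps_pow_coef (M := n.+1) a u0 pE) //.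
transitivity ((map_poly D (binomial_poly a n.+1 p))`_n); first by rewrite coef_map.
rewrite chain coefZ mulr_algl; congr (_ *: _).
apply: (@fps_mul_coef _ _ n) => // i le_in; last exact: (fps_pow_coef _ u0 pE).
rewrite coef_map pE //= raddfB; case: i le_in => [|i] _ /=.
  by rewrite /fps_one eqxx -[1 in X in _ - X]scale1r DA subr0.
by rewrite /fps_one /= raddf0 subr0.
Qed.

(** [z d/dz], which unlike [d/dz] does not shift the coefficients. *)
Definition fps_theta u : nat -> R := fun n => u n *+ n.

Lemma fps_pow_theta a u n : u 0 = 1 ->
  fps_theta (fps_pow a u) n = a *: fps_mul (fps_theta u) (fps_pow (a - 1) u) n.
Proof.
move=> u0; set p := trunc_poly n (u \- fps_one R).
have pE i : (i <= n)%N -> p`_i = (u \- fps_one R) i by exact: coef_trunc_poly.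
have chain : 'X * (binomial_poly a n.+1 p)^`() =
    a%:A *: ('X * p^`() * binomial_poly (a - 1) n p).
  rewrite -mulrA (@binomial_poly_chain a n p (@deriv R)) ?scalerAr //.
    exact: derivM.
  by move=> c q; exact: derivZ.
have thetaE (q : {poly R}) i : ('X * q^`())`_i = q`_i *+ i.
  by rewrite coefXM; case: i => [|i]; rewrite ?mulr0n //= coef_deriv.
rewrite /fps_theta -(fps_pow_coef (M := n.+1) a u0 pE) // -thetaE chain.
rewrite coefZ mulr_algl; congr (_ *: _).
apply: (@fps_mul_coef _ _ n) => // i le_in; last exact: (fps_pow_coef _ u0 pE).
rewrite thetaE pE // /fps_one; case: i le_in => [|i] _ /=.
  by rewrite !mulr0n.
by rewrite subr0.
Qed.

(** [u^a = u u^(a-1)], from the Pascal rule; the two cut series differ by a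
    multiple of [p^(n+1)]. *)
Lemma fps_powS a u n : u 0 = 1 ->
  fps_pow a u n = fps_mul u (fps_pow (a - 1) u) n.
Proof.
move=> u0; set p := trunc_poly n (u \- fps_one R).
have pE i : (i <= n)%N -> p`_i = (u \- fps_one R) i by exact: coef_trunc_poly.
have p0 : p`_0 = 0 by rewrite pE //= u0 subrr.
rewrite -(@fps_mul_coef _ _ n u _ (1 + p) (binomial_poly (a - 1) n p)) //; last 2 first.
- by move=> i le_in; rewrite coefD coef1 pE //= addrC subrK.
- by move=> i le_in; apply: (fps_pow_coef _ u0 pE).
rewrite -(fps_pow_coef (M := n.+1) a u0 pE) //.
suff -> : binomial_poly a n.+1 p = (1 + p) * binomial_poly (a - 1) n p
                            + (gbinom (a - 1) n.+1)%:A *: p ^+ n.+1.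
  by rewrite coefD coefZ coef_exp_lt // mulr0 addr0.
rewrite /binomial_poly mulrDl mul1r big_ord_recl /= !gbinom0.
rewrite (eq_bigr (fun i : 'I_n.+1 => (gbinom (a - 1) i.+1)%:A *: p ^+ i.+1
   + (gbinom (a - 1) i)%:A *: p ^+ i.+1)); last first.
  by move=> i _; rewrite (gbinom_pascal char0 a i) !scalerDl.
rewrite big_split /= addrA mulr_sumr [RHS]addrAC; congr (_ + _); last first.
  by apply: eq_bigr => i _; rewrite -scalerAr -exprS.
rewrite [LHS]addrC big_ord_recr /= addrAC; congr (_ + _).
by rewrite [RHS]big_ord_recl /= gbinom0 addrC.
Qed.

(** Coefficient of [z^n] in [u . z(u^a)' = a . z u' . u^a], which follows from
    [z(u^a)' = a . z u' . u^(a-1)] on multiplying by [u]. *)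
Lemma fps_pow_rec a u n : u 0 = 1 ->
  \sum_(j < n.+1) ((n - j)%:R - a * j%:R) *: (u j * fps_pow a u (n - j)%N) = 0.
Proof.
move=> u0.
have : fps_mul u (fps_theta (fps_pow a u)) n
     = a *: fps_mul (fps_theta u) (fps_pow a u) n.
  transitivity (a *: fps_mul u (fps_mul (fps_theta u) (fps_pow (a - 1) u)) n).
    rewrite [in RHS]fps_mulC -fps_mulZl [RHS]fps_mulC.
    by apply: eq_fps_mul => // i _; apply: fps_pow_theta.
  rewrite fps_mulA; congr (_ *: _).
  transitivity (fps_mul (fps_theta u) (fps_mul u (fps_pow (a - 1) u)) n).
    rewrite fps_mulA; apply: eq_fps_mul => // i _; exact: fps_mulC.
  by apply: eq_fps_mul => // i _; rewrite -fps_powS.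
move/eqP; rewrite -subr_eq0 => /eqP; apply: etrans.
rewrite /fps_mul scaler_sumr -sumrB; apply: eq_bigr => j _.
rewrite scalerBl /fps_theta -scalerA !scaler_nat.
by rewrite mulrnAr mulrnAl.
Qed.

End PowerRules.

(** * The multinomial expansion *)

Section Multinomial.

(** The multinomial theorem divided by [j!].  The truncated exponentials
    [sum_(e <= N) x^e X^e / e!] multiply like exponentials up to degree [N];
    expanding the product of those of the [y_i] and comparing the coefficients
    of [X^j] gives both sides.  The element [kap e] is the inverse of [e!]. *)
Lemma multinomial_coef (A : comNzRingType) (kap : nat -> A) (s N j : nat)
    (y : 'I_s -> A) :
  (forall e, kap e * e`!%:R = 1) -> (j <= N)%N ->
  kap j * (\sum_i y i) ^+ j =
  \sum_(p : {ffun 'I_s -> 'I_N.+1} | (\sum_i p i == j)%N)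
     \prod_i (kap (p i) * y i ^+ p i).
Proof.
move=> kapK le_jN.
have kap_bin i k : (i <= k)%N -> kap k * 'C(k, i)%:R = kap i * kap (k - i)%N.
  move=> le_ik.
  transitivity (kap k * 'C(k, i)%:R * ((kap i * i`!%:R) *
                (kap (k - i)%N * (k - i)`!%:R))); first by rewrite !kapK !mulr1.
  transitivity (kap k * ('C(k, i) * (i`! * (k - i)`!))%N%:R *
                (kap i * kap (k - i)%N)); first by rewrite !natrM; ring.
  by rewrite bin_fact // kapK mul1r.
pose E x : {poly A} := \poly_(e < N.+1) (kap e * x ^+ e).
pose agrees (q : {poly A}) x := forall e, (e <= N)%N -> q`_e = kap e * x ^+ e.
have prodE : agrees (\prod_i E (y i)) (\sum_i y i).
  apply: (big_ind2 agrees).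
  - have kap0 : kap 0 = 1 by rewrite -(kapK 0) mulr1.
    move=> [|e] _; first by rewrite coef1 kap0 expr0 mulr1.
    by rewrite coef1 expr0n mulr0.
  - move=> q1 x1 q2 x2 h1 h2 e le_eN.
    rewrite [x1 + x2]addrC coefM exprDn mulr_sumr; apply: eq_bigr => i _.
    have le_ie : (i <= e)%N by rewrite -ltnS.
    rewrite h1 ?h2; [|by lia|by lia].
    rewrite -[X in _ = kap e * X]mulr_natl [RHS]mulrA kap_bin //; ring.
  - by move=> i _ e le_eN; rewrite coef_poly ltnS le_eN.
rewrite -prodE //; under eq_bigr do rewrite /E poly_def.
rewrite bigA_distr_bigA coef_sum [RHS]big_mkcond; apply: eq_bigr => p _ /=.
under eq_bigr do rewrite -mul_polyC.
rewrite big_split /= -rmorph_prod -expr_sum coefCM coefXn eq_sym.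
by case: ifP; rewrite ?mulr1 ?mulr0.
Qed.

Variables (f : fieldType) (char0 : [pchar f] =i pred0) (R : comAlgType f).

(** The multinomial theorem for [y_i = w_(i+1) z^(i+1)]: the weight of a family
    of exponents is the power of [z] that it contributes. *)
Lemma fps_exp_partitions (w : nat -> R) j n : w 0 = 0 -> (j <= n)%N ->
  fps_exp w j n =
  \sum_(p in partitions n | plength p == j)
     (j`!%:R / \prod_(i < n) (p i)`!%:R) *: \prod_(i < n) w i.+1 ^+ p i.
Proof.
move=> w0 le_jn.
pose y (i : 'I_n) : {poly R} := (w i.+1)%:P * 'X^(i.+1).
pose inv_fact e : f := (e`!%:R)^-1.
pose kap e : {poly R} := ((inv_fact e)%:A)%:P.
have kapK e : kap e * e`!%:R = 1.
  rewrite -[e`!%:R]polyC_natr -polyCM mulr_natr scalerMnl -mulr_natl.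
  by rewrite mulfV ?fact_neq0 // scale1r.
have sumE i : (i <= n)%N -> (\sum_i y i)`_i = w i.
  case: i => [|i] lt_in; rewrite coef_sum.
    by rewrite w0 big1 // => i _; rewrite coefCM coefXn mulr0.
  rewrite (bigD1 (Ordinal lt_in)) //= coefCM coefXn eqxx mulr1 big1 ?addr0 //.
  move=> k; rewrite -val_eqE /= => /negPf neq.
  by rewrite coefCM coefXn eqSS eq_sym neq mulr0.
have -> : fps_exp w j n = j`!%:R *: (kap j * (\sum_i y i) ^+ j)`_n.
  rewrite coefCM (fps_exp_coef _ sumE) // mulr_algl scalerA.
  by rewrite mulfV ?fact_neq0 // scale1r.
rewrite (multinomial_coef y kapK le_jn) coef_sum scaler_sumr.
rewrite [LHS]big_mkcond [RHS]big_mkcond; apply: eq_bigr => p _ /=.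
rewrite -/(plength p) inE; case: ifP; rewrite ?andbT ?andbF // => _.
have -> : \prod_i (kap (p i) * y i ^+ p i) =
    (\prod_i ((inv_fact (p i))%:A * w i.+1 ^+ p i))%:P
      * 'X^(\sum_(i < n) i.+1 * p i).
  rewrite rmorph_prod expr_sum -big_split; apply: eq_bigr => i _ /=.
  by rewrite exprMn -exprM rmorphM rmorphXn mulrA.
rewrite coefCM coefXn eq_sym; case: ifP; rewrite ?mulr0 ?scaler0 // => _.
rewrite mulr1 big_split /= -(rmorph_prod (GRing.in_alg R)) /= mulr_algl.
by rewrite scalerA prodfV.
Qed.

Lemma plength_le n (p : {ffun 'I_n -> 'I_n.+1}) :
  p \in partitions n -> (plength p <= n)%N.
Proof.
rewrite inE => /eqP pn; rewrite -[X in (_ <= X)%N]pn.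
by apply: leq_sum => i _; rewrite mulSn leq_addr.
Qed.

Lemma fps_pow_partitions (a : f) (u : nat -> R) n : u 0 = 1 ->
  fps_pow a u n =
  \sum_(p in partitions n) gmultinom a p *: \prod_(i < n) u i.+1 ^+ p i.
Proof.
move=> u0; rewrite /fps_pow.
(* The partitions of n are sorted by length, the exponent j in the series. *)
transitivity (\sum_(j < n.+1) \sum_(p in partitions n | plength p == j)
     gmultinom a p *: \prod_(i < n) u i.+1 ^+ p i).
  apply: eq_bigr => j _; rewrite fps_exp_partitions ?leq_ord //; last first.
    by rewrite /fps_one /= u0 subrr.
  rewrite scaler_sumr; apply: eq_bigr => p /andP[_ /eqP pj].
  rewrite scalerA mulrA gbinom_fact // /gmultinom pj; congr (_ *: _).
  by apply: eq_bigr => i _; rewrite /fps_one /= subr0.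
rewrite (partition_big (fun p => inord (plength p) : 'I_n.+1) xpredT) //=.
apply: eq_bigr => j _; apply: eq_bigl => p; apply: andb_id2l => /plength_le pn.
by rewrite -val_eqE /= inordK.
Qed.

End Multinomial.

(** * Partitions with a large part *)

Section LargestPart.

Lemma plargestP n (p : {ffun 'I_n -> 'I_n.+1}) m :
  reflect (exists2 i : 'I_n, (0 < p i)%N & (m <= i)%N) (m < plargest p)%N.
Proof.
rewrite ltnNge; apply: (iffP idP) => [|[i p_i le_mi]].
  rewrite /plargest => /bigmax_leqP/=/forall_inP.
  rewrite negb_forall_in => /exists_inP[i p_i]; rewrite -ltnNge ltnS => le_mi.
  by exists i.
by rewrite -ltnNge (leq_trans _ (leq_bigmax_cond (F := fun i : 'I_n => i.+1) i p_i)).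
Qed.

(** [p_0 = k - plength p] comes from this count: substituting
    [x_i x_0^(i-1)] for each part [i] produces [x_0] to the power
    [n - plength p]. *)
Lemma partition_excess n (p : {ffun 'I_n -> 'I_n.+1}) : p \in partitions n ->
  (\sum_(i < n) i * p i + plength p = n)%N.
Proof.
rewrite inE => /eqP pn; rewrite -[RHS]pn /plength -big_split /=.
by apply: eq_bigr => i _; rewrite mulSn addnC.
Qed.

(** A part larger than [m] already accounts for [m] of the difference between
    the weight [m + k] and the length. *)
Lemma pindex_plength m k (p : {ffun 'I_(m + k) -> 'I_(m + k).+1}) :
  p \in pindex m k -> (plength p <= k)%N.
Proof.
rewrite inE => /andP[/partition_excess pn /plargestP[i p_i le_mi]].
have : (i * p i <= \sum_(i < m + k) i * p i)%N by rewrite (bigD1 i) //= leq_addr.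
have : (i <= i * p i)%N by rewrite leq_pmulr.
lia.
Qed.

End LargestPart.

Section SeriesOfVariables.
Variables (f : fieldType) (char0 : [pchar f] =i pred0) (R : comAlgType f).
Implicit Types (x u : nat -> R) (a : f).

(** [xseries] over any algebra: it is needed in [f[x_0, ..., x_(m+k)]] too,
    where determinants and partial derivatives live. *)
Definition xser x : nat -> R := fun i => if i is j.+1 then x i * x 0 ^+ j else 1.

Lemma xser_addS x m c : xser x (m + c.+1) = x (m + c.+1)%N * x 0 ^+ (m + c).
Proof. by rewrite addnS. Qed.

Lemma eq_fps_exp u v j n :
  (forall i, (i <= n)%N -> u i = v i) -> fps_exp u j n = fps_exp v j n.
Proof.
move=> uv; rewrite -(fps_exp_coef j (@coef_trunc_poly _ _ n v) (leqnn n)).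
by symmetry; apply: fps_exp_coef (leqnn n) => i le_in; rewrite coef_trunc_poly ?uv.
Qed.

Lemma eq_fps_pow a u v n :
  (forall i, (i <= n)%N -> u i = v i) -> fps_pow a u n = fps_pow a v n.
Proof.
move=> uv; apply: eq_bigr => j _; congr (_ *: _); apply: eq_fps_exp => i le_in.
by rewrite /= uv.
Qed.

Definition xmono x m k (p : {ffun 'I_(m + k) -> 'I_(m + k).+1}) : R :=
  x 0 ^+ (k - plength p) * \prod_(i < m + k) x i.+1 ^+ p i.

(** Truncation at [m] kills the partitions with a part larger than [m] and
    leaves the terms of all others unchanged, so that the latter cancel. *)
Lemma pow_sub_trunc a x m k :
  fps_pow a (xser x) (m + k) - fps_pow a (fps_trunc m (xser x)) (m + k) =
  x 0 ^+ m * \sum_(p in pindex m k) gmultinom a p *: xmono x p.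
Proof.
rewrite !fps_pow_partitions // -sumrB mulr_sumr.
rewrite (bigID (fun p : {ffun _} => m < plargest p)%N) /= addrC big1 ?add0r.
  rewrite [LHS](eq_bigl (fun p => p \in pindex m k)) => [|p]; last by rewrite !inE.
  apply: eq_bigr => p p_mk; have le_pk := pindex_plength p_mk.
  move: p_mk; rewrite inE => /andP[pn /plargestP[i p_i le_mi]].
  rewrite -scalerBr -scalerAr; congr (_ *: _).
  rewrite [X in _ - X](bigD1 i) //= /fps_trunc ltnNge le_mi /= expr0n.
  rewrite gtn_eqF // mul0r subr0 /xmono mulrA -exprD.
  have -> : (m + (k - plength p) = \sum_(i < m + k) i * p i)%N.
    by rewrite -[RHS](addnK (plength p)) (partition_excess pn) addnBA.
  rewrite expr_sum -big_split; apply: eq_bigr => j _ /=.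
  by rewrite exprMn -exprM mulrC.
move=> p /andP[pn /plargestP small]; rewrite -scalerBr.
apply/eqP; rewrite scaler_eq0 subr_eq0; apply/orP; right; apply/eqP.
apply: eq_bigr => i _; rewrite /fps_trunc; case: ifP => // /negbT.
rewrite -ltnNge ltnS => le_mi; case: (posnP (p i)) => [->|p_i] //.
by case: small; exists i.
Qed.

End SeriesOfVariables.

(** [inf_embed] is injective because it has a left inverse, which sends the
    variables [x_i] with [i >= n] to 1. *)
Module Embedding.
Import finmap monalg.

Section Injective.
Variables (f : fieldType) (n : nat).

Definition restrict_monom (c : {cmonom nat}) : mpoly n f :=
  'X_[ [multinom c i | i < n] ].

Lemma restrict_monom_is_multiplicative : mmorphism restrict_monom.
Proof.
split=> [c1 c2|]; rewrite /restrict_monom.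
  rewrite -mpolyXD; congr 'X_[_]; apply/mnmP => i.
  by rewrite mnmDE !mnmE cmM.
rewrite -mpolyX0; congr 'X_[_]; apply/mnmP => i.
by rewrite mnm0E mnmE cm1.
Qed.

HB.instance Definition _ := isMultiplicative.Build _ _ restrict_monom
  restrict_monom_is_multiplicative.

Definition restrict : InfPoly.ring f -> mpoly n f :=
  monalg.mmap (@mpolyC n f) restrict_monom.

Lemma inf_embedK : cancel (@inf_embed f n) restrict.
Proof.
move=> p; rewrite /restrict /inf_embed /mpoly.mmap raddf_sum [RHS]mpolyE /=.
apply: eq_bigr => e _; rewrite rmorphM /=.
rewrite monalg.mmapZ monalg.mmap1 mulr1 mul_mpolyC; congr (_ *: _).
rewrite /mpoly.mmap1 rmorph_prod mpolyXE_id /=; apply: eq_bigr => i _.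
rewrite rmorphXn /= monalg.mmapU /= mpolyC1 mul1r; congr (_ ^+ _).
congr 'X_[_]; apply/mnmP => j.
by rewrite mnmE cmU mnm1E.
Qed.

End Injective.
End Embedding.

(** * The solution as a sum over partitions *)

Section Solution.
Variables (f : fieldType) (char0 : [pchar f] =i pred0) (lam : f).
Local Notation a := (-1 / lam).

Definition partition_poly m k : {mpoly f[(m + k).+1]} :=
  \sum_(p in pindex m k) pterm lam p.

Lemma xv_neq0 n i : xv i != 0 :> {mpoly f[n.+1]}.
Proof.
apply/eqP => /(congr1 (mcoeff U_(inord i))); rewrite mcoeffX eqxx mcoeff0.
by move/eqP; rewrite oner_eq0.
Qed.

Lemma pterm_xmono m k (p : {ffun 'I_(m + k) -> 'I_(m + k).+1}) :
  pterm lam p = gmultinom a p *: xmono (@xv f (m + k)) p.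
Proof. by []. Qed.

Section Evaluation.
Variables (R : comAlgType f) (x : nat -> R) (n : nat).
Let ev := @mmap n.+1 f R (GRing.in_alg R) (fun i => x i).

Lemma mmap_xv i : (i <= n)%N -> ev (xv i) = x i.
Proof. by move=> le_in; rewrite /ev /xv mmapX mmap1U inordK. Qed.

Lemma mmap_xv_exp m q : ev (xv 0 ^+ m * q) = x 0 ^+ m * ev q.
Proof. by rewrite [LHS]rmorphM rmorphXn /= -[mmap _ _ _]/(ev _) mmap_xv. Qed.

End Evaluation.

Lemma mmap_pterm (R : comAlgType f) (x : nat -> R) m k
    (p : {ffun 'I_(m + k) -> 'I_(m + k).+1}) :
  mmap (GRing.in_alg R) (fun i : 'I_(m + k).+1 => x i) (pterm lam p) =
  gmultinom a p *: xmono x p.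
Proof.
rewrite pterm_xmono mmapZ mulr_algl /xmono mmap_xv_exp rmorph_prod /=.
congr (_ *: (_ * _)).
by apply: eq_bigr => i _; rewrite rmorphXn /= mmap_xv.
Qed.

Lemma inf_embed_partition_poly m k :
  InfPoly.var f 0 ^+ m * inf_embed (partition_poly m k) =
  fps_pow a (@xseries f) (m + k) - fps_pow a (fps_trunc m (@xseries f)) (m + k).
Proof.
rewrite (pow_sub_trunc char0 a (InfPoly.var f)); congr (_ * _).
rewrite /partition_poly /inf_embed raddf_sum; apply: eq_bigr => p _.
exact: mmap_pterm.
Qed.

Lemma fps_mul_mono (R : comAlgType f) (c : R) m (u : nat -> R) n :
  fps_mul (fps_mono c m) u n = if (m <= n)%N then c * u (n - m)%N else 0.
Proof.
rewrite /fps_mul /fps_mono; case: leqP => [le_mn | lt_nm].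
  rewrite (bigD1 (Ordinal (n := n.+1) le_mn)) //= eqxx big1 ?addr0 // => i.
  by rewrite -val_eqE /= => /negPf ->; rewrite mul0r.
by rewrite big1 // => i _; rewrite ltn_eqF ?mul0r // (leq_ltn_trans _ lt_nm) ?leq_ord.
Qed.

(** For uniqueness, the equation is pulled back along the injective
    [inf_embed] to the integral domain [f[x_0, ..., x_(m+k)]], where [x_0^m] can
    be cancelled. *)
Lemma generatedP (P : forall m k : nat, {mpoly f[(m + k).+1]}) :
  generated lam P <-> forall m k, (0 < k)%N -> P m k = partition_poly m k.
Proof.
split=> [genP m k k_gt0 | PE m n].
  have := genP m (m + k)%N; rewrite fps_mul_mono leq_addr addKn gtn_eqF //.
  rewrite /= -inf_embed_partition_poly => eq_P.
  have embedM q : inf_embed (xv 0 ^+ m * q) =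
      InfPoly.var f 0 ^+ m * inf_embed (q : {mpoly f[(m + k).+1]}).
    exact: mmap_xv_exp.
  have := etrans (embedM _) (etrans eq_P (esym (embedM _))).
  move/(can_inj (@Embedding.inf_embedK f _)).
  have x0 : xv 0 ^+ m != 0 :> {mpoly f[(m + k).+1]}.
    exact: (expf_neq0 m (xv_neq0 _ _)).
  exact: (mulfI x0).
rewrite fps_mul_mono /=; case: leqP => [le_mn | lt_nm]; last first.
  rewrite (@eq_fps_pow _ _ a (fps_trunc m (@xseries f)) (@xseries f)) ?subrr //.
  by move=> i le_in; rewrite /fps_trunc ifT //; lia.
have [n_m|n_m] := eqVneq (n - m)%N 0%N.
  rewrite mulr0 (@eq_fps_pow _ _ a (fps_trunc m (@xseries f)) (@xseries f)) ?subrr //.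
  by move=> i le_in; rewrite /fps_trunc ifT //; lia.
by rewrite PE ?lt0n // inf_embed_partition_poly subnKC.
Qed.

(** The defining identity read in [f[x_0, ..., x_(m+k)]], from which the
    formulas for [P_mk] are obtained by cancelling [x_0^m]. *)
Lemma partition_poly_pow m k :
  xv 0 ^+ m * partition_poly m k =
  fps_pow a (xser (@xv f (m + k))) (m + k)
  - fps_pow a (fps_trunc m (xser (@xv f (m + k)))) (m + k).
Proof. by rewrite pow_sub_trunc. Qed.

End Solution.

(** * Degree and weight *)

Section Homogeneity.
Variables (f : fieldType) (lam : f).

Lemma pterm_homog (m k : nat) (mf : measure (m + k).+1)
    (p : {ffun 'I_(m + k) -> 'I_(m + k).+1}) :
  pterm lam p \is (mf U_(inord 0)%MM * (k - plength p)
    + \sum_(i < m + k) mf U_(inord i.+1)%MM * p i)%N.-homog for mf.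
Proof.
apply: dhomogZ; apply: dhomogM; first by apply: dhomogMn; rewrite dhomogX.
apply: (big_ind2 (fun (q : {mpoly f[(m + k).+1]}) d => q \is d.-homog for mf)).
- exact: dhomog1.
- by move=> q1 d1 q2 d2; apply: dhomogM.
- by move=> i _; apply: dhomogMn; rewrite dhomogX.
Qed.

Lemma wgtU n (i : 'I_n) : wgt U_(i)%MM = i.
Proof.
rewrite /wgt (bigD1 i) //= mnm1E eqxx muln1 big1 ?addn0 // => j /negPf neq.
by rewrite mnm1E eq_sym neq muln0.
Qed.

Lemma partition_poly_homog m k : partition_poly lam m k \is k.-homog.
Proof.
apply: rpred_sum => p p_mk; have := pterm_homog (@mdeg _) p.
rewrite /= mdeg1 mul1n; under eq_bigr do rewrite mdeg1 mul1n.
by rewrite subnK // pindex_plength.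
Qed.

Lemma partition_poly_isobaric m k :
  partition_poly lam m k \is (m + k)%N.-homog for @wgt (m + k).+1.
Proof.
apply: rpred_sum => p; rewrite inE => /andP[]; rewrite inE => /eqP pn _.
have := pterm_homog (@wgt _) p; rewrite /= wgtU inordK // mul0n add0n.
under eq_bigr do rewrite wgtU inordK ?ltnS //.
by rewrite pn.
Qed.

End Homogeneity.

(** * The determinant *)

Section Determinant.

(** The product of the matrix with [w] is concentrated in the first entry, so
    multiplying by the adjugate leaves [(v . w)] times its first column.  The
    last entry of that column is, up to sign, the minor of [A] without its last
    column, which is triangular. *)
Lemma det_over_kernel (R : comNzRingType) K (v : 'rV[R]_K.+1)
    (A : 'M[R]_(K, K.+1)) (w : 'cV[R]_K.+1) :
  A *m w = 0 -> (forall (r : 'I_K) (c : 'I_K.+1), (c < r)%N -> A r c = 0) ->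
  \det (col_mx v A : 'M_(1 + K)) * w ord_max 0 =
  (v *m w) 0 0 * ((-1) ^+ K * \prod_(r < K) A r (widen_ord (leqnSn K) r)).
Proof.
move=> Aw0 Atrig; set M : 'M_(1 + K) := col_mx v A.
have Mw : M *m w = col_mx (v *m w) 0 by rewrite mul_col_mx Aw0.
have cof : \adj M ord_max 0 =
    (-1) ^+ K * \prod_(r < K) A r (widen_ord (leqnSn K) r).
  rewrite mxE /cofactor; congr (_ ^+ _ * _).
  have -> : row' 0 (col' ord_max M) =
      \matrix_(r < K, c < K) A r (widen_ord (leqnSn K) c).
    apply/matrixP => r c; rewrite !mxE.
    case: splitP => [i|i] /=.
      by rewrite ord1.
    move/eqP; rewrite eqSS => /eqP ri.
    have -> : i = r by apply: val_inj.
    congr (A _ _); apply: val_inj; rewrite /= /bump.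
    by rewrite leqNgt ltn_ord.
  rewrite -det_tr det_trig; last first.
    by apply/is_trig_mxP => r c lt_rc; rewrite !mxE Atrig.
  by apply: eq_bigr => r _; rewrite !mxE.
have -> : \det M * w ord_max 0 = (\adj M *m (M *m w)) ord_max 0.
  by rewrite mulmxA mul_adj_mx mul_scalar_mx mxE.
rewrite Mw mxE (bigD1 (0 : 'I_(1 + K))) //= big1 ?addr0.
  rewrite cof mulrC; congr (_ * _).
  by rewrite mxE; case: splitP => // j _; rewrite ord1.
move=> i i_neq0; rewrite [X in _ * X]mxE; case: splitP => [j ij|j _].
  by case/eqP: i_neq0; apply: val_inj; rewrite /= ij ord1.
by rewrite [X in _ * X]mxE mulr0.
Qed.

(** The recurrence says that [A] kills the column of the [x_0^c b_(K-c)]: in row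
    [r] the sum over [c = r + j] is [x_0^(r+1)] times the recurrence for
    [N = K - r].  The last entry [x_0^K] of that column cancels against the
    factor [x_0^K] of the triangular minor. *)
Lemma det_recurrence (R : comNzRingType) K (l : R) (x u b : nat -> R)
    (v : 'rV[R]_K.+1) (A : 'M[R]_(K, K.+1)) :
  GRing.lreg (x 0) -> b 0 = 1 -> (forall j, x j * x 0 ^+ j = x 0 * u j) ->
  (forall N, (0 < N)%N ->
     \sum_(j < N.+1) (N%:R * l + j%:R) * (u j * b (N - j)%N) = 0) ->
  (forall (r : 'I_K) (c : 'I_K.+1), A r c = if (r <= c)%N
     then ((K - r)%:R * l + (c - r)%:R) * x (c - r)%N else 0) ->
  \det (col_mx v A : 'M_(1 + K)) =
  K`!%:R * (- l) ^+ K * \sum_(c < K.+1) v 0 c * (x 0 ^+ c * b (K - c)%N).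
Proof.
move=> x0 b0 xu rec AE.
pose w : 'cV[R]_K.+1 := \col_c (x 0 ^+ c * b (K - c)%N).
have Aw0 : A *m w = 0.
  apply/matrixP => r i; rewrite !mxE.
  transitivity (\sum_(r <= c < K.+1)
     ((K - r)%:R * l + (c - r)%:R) * x (c - r)%N * (x 0 ^+ c * b (K - c)%N)).
    rewrite (big_nat_widenl _ 0) // big_mkord [RHS]big_mkcond /=; apply: eq_bigr => c _.
    by rewrite AE mxE; case: ifP => // _; rewrite mul0r.
  have lt_rK := ltn_ord r.
  rewrite -{1}[r : nat]add0n big_addn big_mkord subSn 1?ltnW //.
  transitivity (x 0 ^+ r.+1 * \sum_(j < (K - r).+1)
     ((K - r)%:R * l + j%:R) * (u j * b (K - r - j)%N)).
    rewrite mulr_sumr; apply: eq_bigr => j _.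
    rewrite addnK -subnDA [(r + j)%N]addnC.
    rewrite exprSr -[x 0 ^+ r * _]/(_) exprD.
    have := xu j; rewrite [x 0 * u j]mulrC => xuj.
    transitivity (((K - r)%:R * l + j%:R) * (x j * x 0 ^+ j) *
                  (x 0 ^+ r * b (K - (j + r))%N)); first by ring.
    by rewrite xuj; ring.
  by rewrite rec ?mulr0 // subn_gt0.
have Atrig (r : 'I_K) (c : 'I_K.+1) : (c < r)%N -> A r c = 0.
  by move=> lt_cr; rewrite AE leqNgt lt_cr.
have := det_over_kernel v Aw0 Atrig; rewrite mxE /= subnn b0 mulr1.
have -> : \prod_(r < K) A r (widen_ord (leqnSn K) r) = K`!%:R * l ^+ K * x 0 ^+ K.
  rewrite (eq_bigr (fun r : 'I_K => (K - r)%:R * (l * x 0))); last first.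
    by move=> r _; rewrite AE /= leqnn subnn addr0 mulrA.
  rewrite big_split /= prodr_const card_ord exprMn mulrA; congr (_ * _ * _).
  rewrite -natr_prod; congr (_%:R).
  rewrite fact_prod big_add1 /= big_mkord (reindex_inj rev_ord_inj) /=.
  by apply: eq_bigr => r _; rewrite subKn.
move=> det_x0; have x0K : GRing.lreg (x 0 ^+ K) by apply: lregX.
apply: x0K; rewrite [LHS]mulrC det_x0 mxE -[- l]mulN1r exprMn.
have -> : \sum_c v 0 c * w c 0 = \sum_(c < K.+1) v 0 c * (x 0 ^+ c * b (K - c)%N).
  by apply: eq_bigr => c _; rewrite mxE.
by ring.
Qed.

End Determinant.

Lemma mpoly_lreg (R : idomainType) n (q : {mpoly R[n]}) : q != 0 -> GRing.lreg q.
Proof. by move=> q0; exact: (mulfI q0). Qed.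

Section DeterminantOfA.
Variables (f : fieldType) (char0 : [pchar f] =i pred0).
Variables (lam : f) (lam_neq0 : lam != 0).
Local Notation a := (-1 / lam).

(** Up to powers of [x_0], the entries of the column killed by [A]. *)
Definition bser n : nat -> {mpoly f[n.+1]} := fps_pow (a - 1) (xser xv).

(** The ring [S] and the morphism [phi] allow for the two uses: the polynomial
    ring itself, and the ring of differential forms over it.  With
    [lam a = -1], the recurrence of [u^(a-1)] times [lam] has the coefficients
    [N lam + j] of [A]. *)
Lemma det_Amx (n K : nat) (S : comNzRingType)
    (phi : {rmorphism {mpoly f[n.+1]} -> S})
    (v : 'rV[S]_K.+1) :
  GRing.lreg (phi (xv 0)) ->
  \det (binom_mx v (map_mx phi (Amx lam K.+1))) =
  phi (K`!%:R * (- lam) ^+ K)%:MP *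
    \sum_(c < K.+1) v 0 c * phi (xv 0 ^+ c * bser n (K - c)%N).
Proof.
move=> phi_x0.
have xser0 : xser (@xv f n) 0 = 1 by [].
rewrite /binom_mx (det_recurrence (l := phi lam%:MP) (x := phi \o xv)
  (u := phi \o xser xv) (b := phi \o bser n)) //=.
- rewrite !rmorphM !rmorphXn !rmorphN !rmorph_nat; congr (_ * _).
  by apply: eq_bigr => c _; rewrite rmorphM rmorphXn.
- by rewrite /bser /fps_pow big_ord1 gbinom0 scale1r rmorph1.
- by case=> [|j]; rewrite -rmorphXn -!rmorphM /= ?mulr1 // mulrCA -exprS.
- move=> N N_gt0; have := fps_pow_rec char0 (a - 1) N xser0.
  move/(congr1 (fun q => phi (lam *: q))); rewrite scaler0 rmorph0 => {2}<-.
  rewrite scaler_sumr rmorph_sum; apply: eq_bigr => j _.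
  rewrite scalerA; have -> : lam * ((N - j)%:R - (a - 1) * j%:R) = N%:R * lam + j%:R.
    by rewrite natrB ?leq_ord //; field.
  rewrite -mul_mpolyC !rmorphM mpolyCD mpolyCM !mpolyC_nat /=.
  by rewrite rmorphD rmorphM !rmorph_nat.
- move=> r c; rewrite !mxE; case: ifP => _; last exact: rmorph0.
  rewrite -mul_mpolyC rmorphM mpolyCD mpolyCM !mpolyC_nat.
  by rewrite rmorphD rmorphM !rmorph_nat.
Qed.


(** * Partial derivatives and the line integral *)

Lemma mderiv_xv n i j : (i <= n)%N -> (j <= n)%N ->
  mderiv (inord i) (@xv f n j) = (i == j)%:R.
Proof.
move=> le_in le_jn; rewrite /xv mderivX mnm1E -val_eqE /= !inordK // eq_sym.
have [->|_] := eqVneq i j; last by rewrite scale0r.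
by rewrite scale1r -mpolyX0; congr 'X_[_]; apply/mnmP => k; rewrite mnmBE subnn mnm0E.
Qed.

(** The chain rule: in degree at most [m+k], [x_(m+c+1)] occurs in [u] only in
    the coefficient [x_(m+c+1) x_0^(m+c)] of [z^(m+c+1)], and it does not occur
    in the truncation. *)
Lemma mderiv_partition_poly m K (c : 'I_K.+1) :
  mderiv (inord (m + c.+1)) (partition_poly lam m K.+1) =
  a *: (xv 0 ^+ c * bser (m + K.+1) (K - c)%N).
Proof.
set n := (m + K.+1)%N; set i := inord _; have lt_cK := ltn_ord c.
have le_mcn : (m + c.+1 <= n)%N by rewrite /n; lia.
have d_x0X e q : mderiv i (xv 0 ^+ e * q) = xv 0 ^+ e * mderiv i q :> {mpoly f[n.+1]}.
  elim: e q => [|e IHe] q; first by rewrite !mul1r.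
  by rewrite exprS -!mulrA mderivM mderiv_xv // addnS mul0r add0r IHe.
have d_xser j : (j <= n)%N -> mderiv i (xser (@xv f n) j) =
    if j == (m + c.+1)%N then xv 0 ^+ (m + c) else 0.
  case: j => [|j] le_jn.
    by rewrite addnS /= -(@mpolyC1 n.+1); apply: mderivC.
  rewrite /= mulrC d_x0X mderiv_xv // eq_sym.
  by rewrite addnS eqSS; case: eqP => [->|_]; rewrite ?mulr1 ?mulr0.
have chain u : u 0 = 1 -> mderiv i (fps_pow a u n) =
    a *: fps_mul (mderiv i \o u) (fps_pow (a - 1) u) n.
  move=> u0; apply: (fps_pow_chain char0 a n (D := mderiv i)) => //.
    exact: mderivM.
  by move=> d; rewrite -mul_mpolyC mulr1; apply: mderivC.
have x0m := expf_neq0 m (xv_neq0 f n 0).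
apply: (mulfI x0m); rewrite -d_x0X partition_poly_pow // raddfB /= !chain //.
rewrite -scalerBr -scalerAr; congr (_ *: _).
rewrite [X in _ - X]big1 ?subr0.
  rewrite /fps_mul (bigD1 (Ordinal (n := n.+1) le_mcn)) //= big1 ?addr0.
    have -> : (n - (m + c.+1) = K - c)%N by rewrite /n; lia.
    by rewrite d_xser // eqxx mulrA -exprD.
  move=> j; rewrite -val_eqE /= => /negPf neq.
  by rewrite d_xser ?leq_ord // neq mul0r.
move=> j _; rewrite /= /fps_trunc; case: leqP => [le_jm|_]; last first.
  by rewrite raddf0 mul0r.
rewrite d_xser ?leq_ord // ltn_eqF ?mul0r //.
by rewrite (leq_ltn_trans le_jm) // addnS ltnS leq_addr.
Qed.

(** Every monomial contains a variable [x_i] with [i > m]. *)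
Lemma partition_poly_at_origin m k : at_origin (partition_poly lam m k) = 0.
Proof.
rewrite /at_origin /partition_poly raddf_sum big1 // => p.
rewrite inE => /andP[_ /plargestP[i p_i le_mi]].
rewrite /=; set ev := mmap _ _.
have ev0 : ev (xv i.+1) = 0.
  by rewrite /ev /xv mmapX mmap1U inordK ?ltnS // ltnNge le_mi.
have evM q1 q2 : ev (q1 * q2) = ev q1 * ev q2 by exact: rmorphM.
rewrite /= /pterm [LHS]mmapZ -/ev (bigD1 i) //= !evM.
rewrite [ev (_ ^+ p i)]rmorphXn /= -/ev ev0.
by rewrite expr0n gtn_eqF // mul0r !mulr0.
Qed.

Lemma partition_poly_integral m K :
  is_line_integral (det_dx_A m K.+1 lam)
    ((K`!%:R * (- lam) ^+ K.+1) *: partition_poly lam m K.+1).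
Proof.
split; last by rewrite /at_origin mmapZ -/(at_origin _) partition_poly_at_origin mulr0.
set n := (m + K.+1)%N.
pose phi : {rmorphism {mpoly f[n.+1]} -> {mpoly {mpoly f[n.+1]}[K.+1]}} :=
  @mpolyC K.+1 {mpoly f[n.+1]}.
have phi_x0 : GRing.lreg (phi (xv 0)).
  by apply: mpoly_lreg; rewrite mpolyC_eq0 xv_neq0.
apply: etrans (esym (det_Amx (\row_(c < K.+1) 'X_c) phi_x0)).
rewrite mulr_sumr; apply: eq_bigr => c _.
rewrite mderivZ mderiv_partition_poly mxE scalerA exprSr.
have -> : K`!%:R * ((- lam) ^+ K * - lam) * a = K`!%:R * (- lam) ^+ K by field.
by rewrite -mul_mpolyC mpolyCM; ring.
Qed.

Lemma det_norm_neq0 K : K`!%:R * (- lam) ^+ K.+1 != 0.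
Proof. by rewrite mulf_neq0 ?fact_neq0 // expf_neq0 // oppr_eq0. Qed.

Lemma det_Amx_id n K (v : 'rV_K.+1) :
  \det (binom_mx v (Amx lam K.+1)) =
  (K`!%:R * (- lam) ^+ K) *:
    \sum_(c < K.+1) v 0 c * (xv 0 ^+ c * bser n (K - c)%N).
Proof.
have -> : Amx lam K.+1 = map_mx idfun (Amx lam K.+1) :> 'M[{mpoly f[n.+1]}]_(K, K.+1).
  by apply/matrixP => r c; rewrite [RHS]mxE.
by rewrite det_Amx ?mul_mpolyC //; apply: mulfI; rewrite xv_neq0.
Qed.

(** For [m = 0] the truncation is the series 1, whose powers are 1. *)
Lemma partition_poly0_pow K :
  partition_poly lam 0 K.+1 = fps_pow a (xser xv) K.+1.
Proof.
rewrite -[LHS]mul1r -(expr0 (xv 0)) partition_poly_pow // [X in _ - X](_ : _ = 0) ?subr0 //.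
rewrite -(@eq_fps_pow _ _ a (fps_one _)); last by case.
have := fps_pow_theta char0 a K.+1 (erefl : fps_one {mpoly f[(0 + K.+1).+1]} 0 = 1).
rewrite /fps_theta /fps_mul big1 => [|[[|i] ?] _]; rewrite ?mulr0n ?mul0r ?mul0rn ?mul0r //.
rewrite scaler0 -scaler_nat => /eqP; rewrite scaler_eq0 natr_eq0 //.
by move/eqP.
Qed.

(** Coefficient of [z^k] in [z (u^a)' = a . z u' . u^(a-1)]. *)
Lemma partition_poly0_sum K :
  K.+1%:R *: partition_poly lam 0 K.+1 =
  a *: \sum_(c < K.+1) (c.+1%:R *: xv c.+1) * (xv 0 ^+ c * bser K.+1 (K - c)%N).
Proof.
rewrite partition_poly0_pow scaler_nat; have := fps_pow_theta char0 a K.+1.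
move=> /(_ _ (xser (@xv f K.+1)) erefl); rewrite /fps_theta => ->; congr (_ *: _).
rewrite /fps_mul big_ord_recl mulr0n mul0r add0r; apply: eq_bigr => c _ /=.
by rewrite scaler_nat !mulrnAl mulrA.
Qed.

End DeterminantOfA.

(** * Large m, and the value at the point with all coordinates 1 *)

Section Linearisation.
Variables (f : fieldType) (char0 : [pchar f] =i pred0) (R : comAlgType f).

(** Only the divisibility of the remainder by [d^2] matters below, since [d]
    will start in degree [m+1]. *)
Lemma pow_sub_first_order (A : comNzRingType) (p d : A) j :
  exists r, p ^+ j.+1 - (p - d) ^+ j.+1 = j.+1%:R * p ^+ j * d + r * d ^+ 2.
Proof.
elim: j => [|j [r IHj]]; first by exists 0; rewrite !expr1; ring.
exists (p * r - j.+1%:R * p ^+ j - r * d).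
have -> : p ^+ j.+2 - (p - d) ^+ j.+2 =
    p * (p ^+ j.+1 - (p - d) ^+ j.+1) + d * (p - d) ^+ j.+1 by rewrite !exprS; ring.
have -> : (p - d) ^+ j.+1 = p ^+ j.+1 - (j.+1%:R * p ^+ j * d + r * d ^+ 2).
  by rewrite -IHj subKr.
by rewrite !exprS; ring.
Qed.

(** The tail [d] of [u] beyond degree [m] is divisible by [z^(m+1)], so the
    remainder, a multiple of [d^2], starts in degree [2m+2]. *)
Lemma fps_pow_sub_trunc_linear (a : f) (u : nat -> R) m n :
  u 0 = 1 -> (n < m.+1.*2)%N ->
  fps_pow a u n - fps_pow a (fps_trunc m u) n =
  a *: fps_mul (u \- fps_trunc m u) (fps_pow (a - 1) u) n.
Proof.
move=> u0 lt_nm; set p := trunc_poly n (u \- fps_one R).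
have pE i : (i <= n)%N -> p`_i = (u \- fps_one R) i by exact: coef_trunc_poly.
pose d1 : {poly R} := \poly_(i < n.+1) u (i + m.+1)%N.
pose d := 'X^(m.+1) * d1.
have dE i : (i <= n)%N -> d`_i = (u \- fps_trunc m u) i.
  move=> le_in; rewrite /d coefXnM ltnS /= /fps_trunc; case: leqP => [_|lt_mi].
    by rewrite subrr.
  by rewrite coef_poly ltnS (leq_trans (leq_subr _ _) le_in) subnK // subr0.
have qE i : (i <= n)%N -> (p - d)`_i = (fps_trunc m u \- fps_one R) i.
  by move=> le_in; rewrite coefB pE // dE //= opprB addrC addrA subrK.
have [r r_eq] : exists r : {poly R},
    binomial_poly a n.+1 p - binomial_poly a n.+1 (p - d) =
    a%:A *: (d * binomial_poly (a - 1) n p) + r * d ^+ 2.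
  rewrite /binomial_poly -sumrB big_ord_recl /= !expr0 subrr add0r mulr_sumr scaler_sumr.
  apply: (big_ind2 (fun x y => exists r, x = y + r * d ^+ 2)).
  - by exists 0; rewrite mul0r addr0.
  - move=> x1 y1 x2 y2 [r1 ->] [r2 ->]; exists (r1 + r2).
    by rewrite mulrDl addrACA.
  move=> i _; have [r r_eq] := pow_sub_first_order p d i.
  exists ((gbinom a i.+1)%:A *: r).
  rewrite -[bump 0 i]/i.+1 -scalerBr r_eq scalerDr -scalerAl; congr (_ + _).
  rewrite -!scalerAr !scalerA -mulrA mulr_natl -scaler_nat scalerA mulrC [_ * d]mulrC.
  congr (_ *: _).
  by rewrite mulr_natl scalerMnl -mulr_natl gbinomSl // -scalerAl mul1r scalerA.
rewrite -(fps_pow_coef (M := n.+1) a u0 pE) //.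
rewrite -(fps_pow_coef (M := n.+1) (u := fps_trunc m u) a u0 qE) //.
rewrite -coefB r_eq coefD coefZ mulr_algl /d exprMn -exprM mulrCA coefXnM.
rewrite muln2 lt_nm addr0; congr (_ *: _).
by apply: (@fps_mul_coef _ _ n) => // i le_in; apply: (fps_pow_coef _ u0 pE).
Qed.
Lemma fps_mul_sub_trunc (u v : nat -> R) m K :
  fps_mul (u \- fps_trunc m u) v (m + K.+1) =
  \sum_(c < K.+1) u (m + c.+1)%N * v (K - c)%N.
Proof.
rewrite /fps_mul -addSn big_split_ord /= big1 ?add0r => [|i _]; last first.
  by rewrite /fps_trunc leq_ord subrr mul0r.
apply: eq_bigr => c _; rewrite /fps_trunc ltnNge leq_addr /= subr0.
by congr (u _ * v _); lia.
Qed.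

End Linearisation.

Section LargeM.
Variables (f : fieldType) (char0 : [pchar f] =i pred0).
Variables (lam : f) (lam_neq0 : lam != 0).
Local Notation a := (-1 / lam).

Lemma partition_poly_linear m K : (K <= m)%N ->
  partition_poly lam m K.+1 =
  a *: \sum_(c < K.+1) xv (m + c.+1) * (xv 0 ^+ c * bser lam (m + K.+1) (K - c)%N).
Proof.
move=> le_Km; apply: (mulfI (expf_neq0 m (xv_neq0 f (m + K.+1) 0))).
rewrite partition_poly_pow // fps_pow_sub_trunc_linear //; last by lia.
rewrite -scalerAr fps_mul_sub_trunc mulr_sumr; congr (_ *: _).
apply: eq_bigr => c _; rewrite xser_addS exprD -/(bser _ _ _); ring.
Qed.

(** The recurrence of [u^b] for [u = 1/(1-z)].  Subtracting it for consecutive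
    [n] gives [(n+1) v_(n+1) = b (v_0 + ... + v_n)] and, after a second
    subtraction, a two-term recurrence. *)
Lemma fps_pow_ones (b : f) (v : nat -> f) : v 0 = 1 ->
  (forall n, \sum_(j < n.+1) ((n - j)%:R - b * j%:R) * v (n - j)%N = 0) ->
  forall n, v n = (-1) ^+ n * gbinom (- b) n.
Proof.
move=> v0 rec; pose s n := \sum_(i < n) v i.
have step n : n.+1%:R * v n.+1 = b * s n.+1.
  have rev k : \sum_(i < k.+1) (i%:R - b * (k - i)%:R) * v i = 0.
    apply: etrans (rec k); rewrite (reindex_inj rev_ord_inj) /=; apply: eq_bigr => i _.
    by rewrite subSS subKn ?leq_ord.
  have := rev n.+1; rewrite big_ord_recr /= subnn mulr0 subr0.
  have -> : \sum_(i < n.+1) (i%:R - b * (n.+1 - i)%:R) * v i = - (b * s n.+1).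
    rewrite -[RHS]add0r -[X in _ = X + _](rev n) mulr_sumr -sumrN -big_split /=.
    apply: eq_bigr => i _; rewrite subSn ?leq_ord // -natr1; ring.
  by move/eqP; rewrite addrC subr_eq0 => /eqP.
have ratio n : n.+1%:R * v n.+1 = (n%:R + b) * v n.
  rewrite step /s big_ord_recr /= mulrDr -/(s n).
  case: n => [|n]; first by rewrite /s big_ord0 mulr0 !add0r.
  by rewrite -step -mulrDl.
elim=> [|n IHn]; first by rewrite v0 gbinom0 mulr1.
have n1 : n.+1%:R != 0 :> f by rewrite natr_eq0.
apply: (mulfI n1); rewrite ratio IHn gbinomS // exprS; field.
by rewrite addrC natr1.
Qed.

Lemma meval_xv n i (v : 'I_n.+1 -> f) : (xv i).@[v] = v (inord i).
Proof. by rewrite /xv mevalXU. Qed.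

Lemma meval_fps_pow1 b n N :
  (fps_pow b (xser (@xv f n)) N).@[fun=> 1] = (-1) ^+ N * gbinom (- b) N.
Proof.
have x1 i : (xser (@xv f n) i).@[fun=> 1] = 1.
  case: i => [|i]; first by rewrite /= meval1.
  by rewrite /= mevalM rmorphXn /= !meval_xv expr1n mulr1.
move: N; apply: (fps_pow_ones (v := fun N => (fps_pow b (xser xv) N).@[_])).
  by rewrite /fps_pow big_ord1 gbinom0 scale1r meval1.
move=> N; have := fps_pow_rec char0 b N (erefl : xser (@xv f n) 0 = 1).
move/(congr1 (meval (fun=> 1))); rewrite raddf_sum meval0; apply: etrans.
apply: eq_bigr => j _; rewrite /= mevalZ mevalM x1 mul1r //.
Qed.

Lemma meval_partition_poly0 K :
  (partition_poly lam 0 K.+1).@[fun=> 1] = (-1) ^+ K.+1 * gbinom (1 / lam) K.+1.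
Proof.
by rewrite partition_poly0_pow // meval_fps_pow1 mulNr opprK.
Qed.

(** At the point with all coordinates 1 the sum in [partition_poly_linear] is
    the coefficient of [z^(k-1)] in [u u^(a-1) = u^a]. *)
Lemma meval_partition_poly_large m K : (K <= m)%N ->
  (partition_poly lam m K.+1).@[fun=> 1] = (-1) ^+ K.+1 / lam * gbinom (1 / lam) K.
Proof.
move=> le_Km; rewrite partition_poly_linear // mevalZ.
transitivity (a * (fps_pow a (xser (@xv f (m + K.+1))) K).@[fun=> 1]); last first.
  by rewrite meval_fps_pow1 mulNr opprK exprS; ring.
congr (_ * _); rewrite fps_powS // /fps_mul !raddf_sum.
apply: eq_bigr => c _; rewrite /= !mevalM -/(bser _ _ _) rmorphXn /= !meval_xv.
rewrite expr1n !mul1r; case: (c : nat) => [|i] /=; first by rewrite meval1 mul1r.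
by rewrite mevalM rmorphXn /= !meval_xv expr1n !mul1r.
Qed.

End LargeM.

(** * Expansions in low degree *)

Section LowDegree.
Variables (f : fieldType) (R : comAlgType f).
Implicit Types (u w : nat -> R) (a : f).
Local Arguments fps_exp : simpl never.

Lemma fps_exp1 w n : fps_exp w 1 n = w n.
Proof. by rewrite -(fps_exp_coef 1 (@coef_trunc_poly _ _ n w)) // expr1 coef_trunc_poly. Qed.

(** With [fps_exp1] and [fps_expS0] this rewrites a concrete [fps_exp w j n]
    into a sum over the compositions of [n] into [j] parts. *)
Lemma fps_expSS w j n : w 0 = 0 ->
  fps_exp w j.+1 n.+1 = \sum_(i < n.+1) w i.+1 * fps_exp w j (n - i)%N.
Proof.
by move=> w0; rewrite [LHS]/(fps_mul _ _ _) /fps_mul big_ord_recl w0 mul0r add0r.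
Qed.

Lemma fps_expS0 w j : w 0 = 0 -> fps_exp w j.+1 0 = 0.
Proof. by move=> w0; rewrite [LHS]/(fps_mul _ _ _) /fps_mul big_ord1 w0 mul0r. Qed.

Local Ltac expand w0 := rewrite
  !(fps_exp1, fps_expSS, fps_expS0, subSS, subn0, big_ord_recl, big_ord0, w0) //=;
  ring.

Lemma fps_exp_square w (w0 : w 0 = 0) :
  [/\ fps_exp w 2 2 = w 1%N ^+ 2,
      fps_exp w 2 3 = 2 * w 1%N * w 2%N,
      fps_exp w 2 4 = 2 * w 1%N * w 3%N + w 2%N ^+ 2,
      fps_exp w 2 5 = 2 * w 1%N * w 4%N + 2 * w 2%N * w 3%N &
      fps_exp w 2 6 = 2 * w 1%N * w 5%N + 2 * w 2%N * w 4%N + w 3%N ^+ 2].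
Proof. by split; expand w0. Qed.

Lemma fps_exp_cube w (w0 : w 0 = 0) :
  [/\ fps_exp w 3 3 = w 1%N ^+ 3,
      fps_exp w 3 4 = 3 * w 1%N ^+ 2 * w 2%N,
      fps_exp w 3 5 = 3 * w 1%N ^+ 2 * w 3%N + 3 * w 1%N * w 2%N ^+ 2 &
      fps_exp w 3 6 = 3 * w 1%N ^+ 2 * w 4%N + 6 * w 1%N * w 2%N * w 3%N + w 2%N ^+ 3].
Proof. by split; expand w0. Qed.

Lemma fps_exp_high w (w0 : w 0 = 0) :
  [/\ fps_exp w 4 4 = w 1%N ^+ 4,
      fps_exp w 4 5 = 4 * w 1%N ^+ 3 * w 2%N,
      fps_exp w 4 6 = 4 * w 1%N ^+ 3 * w 3%N + 6 * w 1%N ^+ 2 * w 2%N ^+ 2,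
      fps_exp w 5 5 = w 1%N ^+ 5 &
      fps_exp w 5 6 = 5 * w 1%N ^+ 4 * w 2%N] /\ fps_exp w 6 6 = w 1%N ^+ 6.
Proof. by split; first split; expand w0. Qed.

Lemma fps_pow_low a u : u 0 = 1 ->
  [/\ fps_pow a u 0 = 1,
      fps_pow a u 1 = gbinom a 1 *: u 1%N,
      fps_pow a u 2 = gbinom a 1 *: u 2%N + gbinom a 2 *: u 1%N ^+ 2 &
      fps_pow a u 3 = gbinom a 1 *: u 3%N + gbinom a 2 *: (2 * u 1%N * u 2%N)
        + gbinom a 3 *: u 1%N ^+ 3] /\
  [/\ fps_pow a u 4 = gbinom a 1 *: u 4%N
        + gbinom a 2 *: (2 * u 1%N * u 3%N + u 2%N ^+ 2)
        + gbinom a 3 *: (3 * u 1%N ^+ 2 * u 2%N) + gbinom a 4 *: u 1%N ^+ 4,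
      fps_pow a u 5 = gbinom a 1 *: u 5%N
        + gbinom a 2 *: (2 * u 1%N * u 4%N + 2 * u 2%N * u 3%N)
        + gbinom a 3 *: (3 * u 1%N ^+ 2 * u 3%N + 3 * u 1%N * u 2%N ^+ 2)
        + gbinom a 4 *: (4 * u 1%N ^+ 3 * u 2%N) + gbinom a 5 *: u 1%N ^+ 5 &
      fps_pow a u 6 = gbinom a 1 *: u 6%N
        + gbinom a 2 *: (2 * u 1%N * u 5%N + 2 * u 2%N * u 4%N + u 3%N ^+ 2)
        + gbinom a 3 *: (3 * u 1%N ^+ 2 * u 4%N + 6 * u 1%N * u 2%N * u 3%N
                         + u 2%N ^+ 3)
        + gbinom a 4 *: (4 * u 1%N ^+ 3 * u 3%N + 6 * u 1%N ^+ 2 * u 2%N ^+ 2)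
        + gbinom a 5 *: (5 * u 1%N ^+ 4 * u 2%N) + gbinom a 6 *: u 1%N ^+ 6].
Proof.
move=> u0; set w := u \- fps_one R.
have w0 : w 0 = 0 by rewrite /w /= u0 subrr.
have wS i : w i.+1 = u i.+1 by rewrite /w /= subr0.
have E0 : fps_exp w 0 0 = 1 by [].
have E0S n : fps_exp w 0 n.+1 = 0 by [].
have [e22 e23 e24 e25 e26] := fps_exp_square w0.
have [e33 e34 e35 e36] := fps_exp_cube w0.
have [[e44 e45 e46 e55 e56] e66] := fps_exp_high w0.
have E := (e22, e23, e24, e25, e26, e33, e34, e35, e36, e44, e45, e46, e55, e56, e66).
split; split; rewrite /fps_pow -/w !big_ord_recr big_ord0 /= add0r ?E0 ?E0S
  ?scaler0 ?add0r ?fps_exp1 ?E ?wS ?gbinom0 ?scale1r //.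

Qed.

End LowDegree.

Section Examples.
Variables (f : fieldType) (char0 : [pchar f] =i pred0).
Variables (lam : f) (lam_neq0 : lam != 0).
Local Notation a := (-1 / lam).


Lemma gbinom_low :
  [/\ gbinom a 1 = - (1 / lam),
      gbinom a 2 = (lam + 1) / (2 * lam ^+ 2),
      gbinom a 3 = - ((lam + 1) * (2 * lam + 1) / (6 * lam ^+ 3)) &
      gbinom a 4 = (lam + 1) * (2 * lam + 1) * (3 * lam + 1) / (24 * lam ^+ 4)].
Proof.
have nz k : k.+1%:R != 0 :> f by rewrite natr_eq0.
have [n2 n3 n4 n6 n24] := And5 (nz 1%N) (nz 2%N) (nz 3%N) (nz 5%N) (nz 23%N).
rewrite !(gbinomS char0) gbinom0.
by split; field; rewrite ?n2 ?n3 ?n4 ?n6 ?n24 ?lam_neq0 ?oner_neq0.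
Qed.

(** The coefficients in the explicit formulas are multiples of the binomial
    coefficients, by the number of orderings of the parts. *)
Lemma gbinom_low_multiples :
  [/\ (lam + 1) / lam ^+ 2 = 2 * gbinom a 2,
      (lam + 1) * (2 * lam + 1) / (2 * lam ^+ 3) = - (3 * gbinom a 3) &
      (lam + 1) * (2 * lam + 1) * (3 * lam + 1) / (6 * lam ^+ 4) = 4 * gbinom a 4].
Proof.
have [_ -> -> ->] := gbinom_low; have nz k : k.+1%:R != 0 :> f by rewrite natr_eq0.
have [n2 n3 n4 n6 n24] := And5 (nz 1%N) (nz 2%N) (nz 3%N) (nz 5%N) (nz 23%N).
by split; field; rewrite ?n2 ?n3 ?n4 ?n6 ?n24 ?lam_neq0 ?oner_neq0.
Qed.

(** Written with [a binom(a-1, j) = (j+1) binom(a, j+1)], so that only the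
    coefficients of [u^a] itself occur. *)
Lemma scaled_bser_low n (x := @xv f n) :
  [/\ a *: bser lam n 0 = (gbinom a 1)%:A,
      a *: bser lam n 1 = (2 * gbinom a 2) *: x 1%N,
      a *: bser lam n 2 = (2 * gbinom a 2) *: (x 2%N * x 0%N)
        + (3 * gbinom a 3) *: x 1%N ^+ 2 &
      a *: bser lam n 3 = (2 * gbinom a 2) *: (x 3%N * x 0%N ^+ 2)
        + (3 * gbinom a 3) *: (2 * x 1%N * x 2%N * x 0%N)
        + (4 * gbinom a 4) *: x 1%N ^+ 3].
Proof.
have [[b0 b1 b2 b3] _] := fps_pow_low (a - 1) (erefl : xser x 0 = 1).
have G j : a * gbinom (a - 1) j = j.+1%:R * gbinom a j.+1 by rewrite gbinomSl.
rewrite /bser b0 b1 b2 b3 !scalerDr !scalerA !G.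
rewrite /= expr0 expr1 !mulr1; split; rewrite ?mulrA //.
by congr (_ *: _); rewrite gbinomS // gbinom0; field; rewrite oner_neq0.
Qed.

Lemma partition_poly_eq m k (q : {mpoly f[(m + k).+1]}) :
  xv 0 ^+ m * q =
    fps_pow a (xser xv) (m + k) - fps_pow a (fps_trunc m (xser xv)) (m + k) ->
  partition_poly lam m k = q.
Proof.
rewrite -partition_poly_pow // => eq_q.
by apply: (mulfI (expf_neq0 m (xv_neq0 f (m + k) 0))).
Qed.

(** The cases with [m >= k-1] come from [partition_poly_linear], those with
    [m = 0] from [partition_poly0_pow], and the remaining three from the
    difference of two coefficients of degree [m + k].  In each case the
    coefficients [binom(a, j)] are kept as unknowns, so that a ring identity
    with integer coefficients remains. *)
Lemma partition_poly_examples (P := partition_poly lam) :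
  (forall m : nat, P m 1%N = (- (1 / lam)) *: xv (m + 1)) /\
  (P 0%N 2%N = (- (1 / lam)) *: (xv 0 * xv 2)
             + ((lam + 1) / (2 * lam ^+ 2)) *: xv 1 ^+ 2) /\
  (forall m : nat, (1 <= m)%N ->
     P m 2%N = (- (1 / lam)) *: (xv 0 * xv (m + 2))
             + ((lam + 1) / lam ^+ 2) *: (xv 1 * xv (m + 1))) /\
  (P 0%N 3%N = (- (1 / lam)) *: (xv 0 ^+ 2 * xv 3)
             + ((lam + 1) / lam ^+ 2) *: (xv 0 * xv 1 * xv 2)
             - ((lam + 1) * (2 * lam + 1) / (6 * lam ^+ 3)) *: xv 1 ^+ 3) /\
  (P 1%N 3%N = (- (1 / lam)) *: (xv 0 ^+ 2 * xv 4)
             + ((lam + 1) / (2 * lam ^+ 2))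
                 *: (xv 0 * (2 * xv 1 * xv 3 + xv 2 ^+ 2))
             - ((lam + 1) * (2 * lam + 1) / (2 * lam ^+ 3))
                 *: (xv 1 ^+ 2 * xv 2)) /\
  (forall m : nat, (2 <= m)%N ->
     P m 3%N = (- (1 / lam)) *: (xv 0 ^+ 2 * xv (m + 3))
             + ((lam + 1) / lam ^+ 2)
                 *: (xv 0 * (xv 1 * xv (m + 2) + xv 2 * xv (m + 1)))
             - ((lam + 1) * (2 * lam + 1) / (2 * lam ^+ 3))
                 *: (xv 1 ^+ 2 * xv (m + 1))) /\
  (P 0%N 4%N = (- (1 / lam)) *: (xv 0 ^+ 3 * xv 4)
             + ((lam + 1) / (2 * lam ^+ 2))
                 *: (xv 0 ^+ 2 * (2 * xv 1 * xv 3 + xv 2 ^+ 2))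
             - ((lam + 1) * (2 * lam + 1) / (2 * lam ^+ 3))
                 *: (xv 0 * xv 1 ^+ 2 * xv 2)
             + ((lam + 1) * (2 * lam + 1) * (3 * lam + 1) / (24 * lam ^+ 4))
                 *: xv 1 ^+ 4) /\
  (P 1%N 4%N = (- (1 / lam)) *: (xv 0 ^+ 3 * xv 5)
             + ((lam + 1) / lam ^+ 2)
                 *: (xv 0 ^+ 2 * (xv 1 * xv 4 + xv 2 * xv 3))
             - ((lam + 1) * (2 * lam + 1) / (2 * lam ^+ 3))
                 *: (xv 0 * (xv 1 ^+ 2 * xv 3 + xv 1 * xv 2 ^+ 2))
             + ((lam + 1) * (2 * lam + 1) * (3 * lam + 1) / (6 * lam ^+ 4))
                 *: (xv 1 ^+ 3 * xv 2)) /\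
  (P 2%N 4%N = (- (1 / lam)) *: (xv 0 ^+ 3 * xv 6)
             + ((lam + 1) / (2 * lam ^+ 2))
                 *: (xv 0 ^+ 2
                     * (2 * xv 1 * xv 5 + 2 * xv 2 * xv 4 + xv 3 ^+ 2))
             - ((lam + 1) * (2 * lam + 1) / (2 * lam ^+ 3))
                 *: (xv 0 * (xv 1 ^+ 2 * xv 4 + 2 * xv 1 * xv 2 * xv 3))
             + ((lam + 1) * (2 * lam + 1) * (3 * lam + 1) / (6 * lam ^+ 4))
                 *: (xv 1 ^+ 3 * xv 3)) /\
  (forall m : nat, (3 <= m)%N ->
     P m 4%N = (- (1 / lam)) *: (xv 0 ^+ 3 * xv (m + 4))
             + ((lam + 1) / lam ^+ 2)
                 *: (xv 0 ^+ 2 * (xv 1 * xv (m + 3) + xv 2 * xv (m + 2)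
                                  + xv 3 * xv (m + 1)))
             - ((lam + 1) * (2 * lam + 1) / (2 * lam ^+ 3))
                 *: (xv 0 * (xv 1 ^+ 2 * xv (m + 2)
                             + 2 * xv 1 * xv 2 * xv (m + 1)))
             + ((lam + 1) * (2 * lam + 1) * (3 * lam + 1) / (6 * lam ^+ 4))
                 *: (xv 1 ^+ 3 * xv (m + 1))).
Proof.
have [g1 g2 g3 g4] := gbinom_low; have [h2 h3 h4] := gbinom_low_multiples.
have g3' : (lam + 1) * (2 * lam + 1) / (6 * lam ^+ 3) = - gbinom a 3 by rewrite g3 opprK.
rewrite -g1 -g2 g3' -g4 h2 h3 h4 /P {g1 g2 g3 g4 h2 h3 h4 g3'}.
have large m K : (K <= m)%N -> partition_poly lam m K.+1 =
    \sum_(c < K.+1) xv (m + c.+1) * xv 0 ^+ c * (a *: bser lam (m + K.+1) (K - c)%N).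
  move=> le_Km; rewrite partition_poly_linear // scaler_sumr; apply: eq_bigr => c _.
  by rewrite -!scalerAr mulrA.
split=> [m|].
  have [b0 _ _ _] := scaled_bser_low (m + 1).
  by rewrite large // big_ord1 b0 -mulrA mul1r -scalerAr mulr1.
have d0 n : xser (@xv f n) 0 = 1 by [].
have trunc0 n m : fps_trunc m (xser (@xv f n)) 0 = 1 by [].
split.
  rewrite partition_poly0_pow //; have [[_ _ -> _] _] := fps_pow_low a (d0 2).
  rewrite /= -!mul_mpolyC; ring.
split=> [m le_m|].
  have [b0 b1 _ _] := scaled_bser_low (m + 2).
  rewrite large // !big_ord_recr big_ord0 /= ?subnn ?subn0 b0 b1.
  rewrite -!mul_mpolyC; ring.
split.
  rewrite partition_poly0_pow //; have [[_ _ _ ->] _] := fps_pow_low a (d0 3).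
  rewrite /= -!mul_mpolyC; ring.
split.
  apply: partition_poly_eq; have [_ [e _ _]] := fps_pow_low a (d0 (1 + 3)%N).
  have [_ [et _ _]] := fps_pow_low a (trunc0 (1 + 3)%N 1%N).
  rewrite [fps_pow _ (xser _) _]e [fps_pow _ (fps_trunc _ _) _]et.
  rewrite /fps_trunc /= -!mul_mpolyC; ring.
split=> [m le_m|].
  have [b0 b1 b2 _] := scaled_bser_low (m + 3).
  rewrite large // !big_ord_recr big_ord0 /= ?subnn ?subn0 -[(2 - 1)%N]/1%N b0 b1 b2.
  rewrite -!mul_mpolyC; ring.
split.
  rewrite partition_poly0_pow //; have [_ [-> _ _]] := fps_pow_low a (d0 4).
  rewrite /= -!mul_mpolyC; ring.
split.
  apply: partition_poly_eq; have [_ [_ e _]] := fps_pow_low a (d0 (1 + 4)%N).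
  have [_ [_ et _]] := fps_pow_low a (trunc0 (1 + 4)%N 1%N).
  rewrite [fps_pow _ (xser _) _]e [fps_pow _ (fps_trunc _ _) _]et.
  rewrite /fps_trunc /= -!mul_mpolyC; ring.
split=> [|m le_m].
  apply: partition_poly_eq; have [_ [_ _ e]] := fps_pow_low a (d0 (2 + 4)%N).
  have [_ [_ _ et]] := fps_pow_low a (trunc0 (2 + 4)%N 2%N).
  rewrite [fps_pow _ (xser _) _]e [fps_pow _ (fps_trunc _ _) _]et.
  rewrite /fps_trunc /= -!mul_mpolyC; ring.
have [b0 b1 b2 b3] := scaled_bser_low (m + 4).
rewrite large // !big_ord_recr big_ord0 /= ?subnn ?subn0.
rewrite -[(3 - 1)%N]/2%N -[(3 - 2)%N]/1%N b0 b1 b2 b3 -!mul_mpolyC; ring.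
Qed.


End Examples.

(** * Counting partitions by removing the largest part *)

Section RemoveLargestPart.

(** The multiplicity of the part [i + 1], for any [i], so that partitions of
    different numbers can be compared. *)
Definition multiplicity j (q : {ffun 'I_j -> 'I_j.+1}) (i : nat) : nat :=
  if insub i is Some i' then q i' else 0.

Lemma multiplicity_ord j (q : {ffun 'I_j -> 'I_j.+1}) (i : 'I_j) : multiplicity q i = q i.
Proof. by rewrite /multiplicity valK. Qed.

Lemma multiplicity_ge j (q : {ffun 'I_j -> 'I_j.+1}) i : (j <= i)%N -> multiplicity q i = 0%N.
Proof. by move=> le_ji; rewrite /multiplicity insubF // ltnNge le_ji. Qed.

Lemma multiplicity_le j (q : {ffun 'I_j -> 'I_j.+1}) i : (multiplicity q i <= j)%N.
Proof. by rewrite /multiplicity; case: insubP => // i' _ _; rewrite -ltnS. Qed.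

Lemma sum_multiplicity j (q : {ffun 'I_j -> 'I_j.+1}) n (F : nat -> nat) : (j <= n)%N ->
  (\sum_(i < n) F i * multiplicity q i = \sum_(i < j) F i * q i)%N.
Proof.
move=> le_jn; transitivity (\sum_(i < j) F i * multiplicity q i)%N; last first.
  by apply: eq_bigr => i _; rewrite multiplicity_ord.
rewrite (big_ord_widen n (fun i => F i * multiplicity q i)%N le_jn) [RHS]big_mkcond /=.
by apply: eq_bigr => i _; case: ltnP => // le_ji; rewrite multiplicity_ge ?muln0.
Qed.

Variables (m K : nat) (le_Km : (K <= m)%N).
Local Notation n := (m + K.+1)%N.

(** A new largest part [n - j] is added to a partition of [j].  For
    [j <= K <= m] it is larger than [j], hence larger than every old part, and
    larger than [m]. *)
Definition add_part j (q : {ffun 'I_j -> 'I_j.+1}) : {ffun 'I_n -> 'I_n.+1} :=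
  [ffun i : 'I_n => inord (multiplicity q i + (i.+1 == n - j))%N].

Variables (j : nat) (lt_jK : (j < K.+1)%N).
Implicit Type q : {ffun 'I_j -> 'I_j.+1}.

Lemma add_partE q i : add_part q i = (multiplicity q i + (i.+1 == n - j))%N :> nat.
Proof.
rewrite ffunE inordK //; have := multiplicity_le q i.
by case: (_ == _); lia.
Qed.

Lemma sum_add_part q (F : nat -> nat) :
  (\sum_(i < n) F i * add_part q i = \sum_(i < j) F i * q i + F (n - j).-1)%N.
Proof.
under eq_bigr do rewrite add_partE mulnDr.
rewrite big_split /= sum_multiplicity; last by lia.
have lt_n : ((n - j).-1 < n)%N by lia.
congr (_ + _)%N; rewrite (bigD1 (Ordinal lt_n)) //= big1 => [|i].
  by rewrite prednK ?eqxx ?muln1 ?addn0 //; lia.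
rewrite -val_eqE /= => neq.
have -> : (i.+1 == n - j)%N = false by lia.
by rewrite muln0.
Qed.

Lemma plength_add_part q : plength (add_part q) = (plength q).+1.
Proof.
have := sum_add_part q (fun=> 1%N); rewrite addn1.
by under eq_bigr do rewrite mul1n; under [in RHS]eq_bigr do rewrite mul1n.
Qed.

Lemma add_part_partition q : (add_part q \in partitions n) = (q \in partitions j).
Proof.
rewrite !inE (sum_add_part q S) prednK; last by lia.
by apply/eqP/eqP; lia.
Qed.

Lemma plargest_add_part q : q \in partitions j -> plargest (add_part q) = (n - j)%N.
Proof.
move=> qj; apply/eqP; rewrite eqn_leq; apply/andP; split.
  rewrite leqNgt; apply/plargestP => -[i]; rewrite add_partE => p_i le_i.
  by move: p_i; rewrite multiplicity_ge ?gtn_eqF //; lia.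
have lt_n : ((n - j).-1 < n)%N by lia.
have -> : (n - j = (n - j).-1.+1)%N by lia.
apply/plargestP; exists (Ordinal lt_n) => //.
by rewrite add_partE /= prednK ?eqxx ?addn1 //; lia.
Qed.

Lemma add_part_inj : injective (@add_part j).
Proof.
move=> q1 q2 eq_q; apply/ffunP => i; apply: val_inj.
have lt_in : (i < n)%N by have := ltn_ord i; lia.
have := congr1 (fun p : {ffun 'I_n -> 'I_n.+1} => val (p (Ordinal lt_in))) eq_q.
by rewrite /= !add_partE !multiplicity_ord => /addIn.
Qed.

(** If the largest part is [n - j > j], the other parts have sum [j], so it is
    simple and all other parts are at most [j]. *)
Lemma add_part_onto (p : {ffun 'I_n -> 'I_n.+1}) :
  p \in partitions n -> plargest p = (n - j)%N ->
  exists q, p = add_part q.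
Proof.
move=> pn pL; have le_jn : (j <= n)%N by lia.
exists [ffun i => inord (p (widen_ord le_jn i))].
 have lt_n : ((n - j).-1 < n)%N by lia.
pose L := Ordinal lt_n.
have p_L : (0 < p L)%N.
  have : ((n - j).-1 < plargest p)%N by rewrite pL; lia.
  case/plargestP => i p_i le_i; suff -> : L = i by [].
  apply: val_inj => /=; apply/eqP; rewrite eqn_leq le_i /=.
  rewrite leqNgt; apply/negP => lt_i.
  suff : (n - j < plargest p)%N by rewrite pL ltnn.
  by apply/plargestP; exists i => //; lia.
move: pn; rewrite inE => /eqP pn.
have sumL := pn; rewrite (bigD1 L) //= prednK in sumL; last by lia.
have p_L1 : p L = 1%N :> nat.
  apply/eqP; rewrite eqn_leq p_L andbT leqNgt; apply/negP => p_L2.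
  have : ((n - j) * 2 <= (n - j) * p L)%N by rewrite leq_mul2l p_L2 orbT.
  lia.
have others i : i != L -> (i.+1 * p i <= j)%N.
  by move=> neq; rewrite (bigD1 i) //= in sumL; rewrite p_L1 in sumL; lia.
apply/ffunP => i; apply: val_inj; rewrite /= add_partE //.
have [->|neq] := eqVneq i L.
  by rewrite p_L1 multiplicity_ge /= ?prednK ?eqxx //; lia.
have -> : (i.+1 == n - j)%N = false.
  by move: neq; rewrite -val_eqE /=; lia.
have le_pi := others i neq; rewrite addn0.
have [le_ji|lt_ij] := leqP j i.
  by rewrite multiplicity_ge //; nia.
rewrite -[i : nat]/(nat_of_ord (Ordinal lt_ij)) multiplicity_ord ffunE /= inordK.
  by congr (nat_of_ord (p _)); apply: val_inj.
rewrite (_ : widen_ord _ _ = i); last exact: val_inj.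
by rewrite ltnS; nia.
Qed.

End RemoveLargestPart.

Section Count.

Lemma pindex0 k : (0 < k)%N -> pindex 0 k = partitions k.
Proof.
move=> k_gt0; apply/setP => p; rewrite inE andb_idr // inE => /eqP pk.
apply/plargestP; apply/exists_inP; apply: contraLR k_gt0.
move=> /exists_inPn none; move: pk; rewrite big1 => [/esym|i _].
  by rewrite add0n => /eqP; rewrite eqn0Ngt.
have [->|p_i] := posnP (p i); first by rewrite muln0.
by have := none i p_i.
Qed.

(** The partitions are sorted by [j = n - plargest p], and [add_part] is a
    bijection onto each class that raises the length by one. *)
Lemma card_pindex_plength m K b : (K <= m)%N ->
  #|[set p in pindex m K.+1 | plength p <= b]%N| =
  (\sum_(j < K.+1) #|[set q in partitions j | plength q < b]%N|)%N.
Proof.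
move=> le_Km; rewrite -sum1_card.
rewrite (partition_big (fun p => inord (m + K.+1 - plargest p)%N : 'I_K.+1) xpredT) //=.
apply: eq_bigr => j _; have lt_jK := ltn_ord j.
rewrite -(card_imset _ (add_part_inj le_Km lt_jK)) -sum1_card.
apply: eq_bigl => p; rewrite !inE; apply/idP/imsetP; last first.
  case=> q; rewrite !inE => /andP[qj q_b] ->.
  have := add_part_partition le_Km lt_jK q; rewrite !inE qj => ->.
  rewrite plength_add_part // q_b plargest_add_part ?inE //.
  rewrite -val_eqE /= inordK; lia.
move=> /andP[/andP[/andP[pn p_m] p_b]]; rewrite -val_eqE /= => p_j.
have le_pn : (plargest p <= m + K.+1)%N.
  by rewrite leqNgt; apply/plargestP => -[i _]; rewrite leqNgt ltn_ord.
have pL : plargest p = (m + K.+1 - j)%N.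
  by move: p_j; rewrite inordK; lia.
have [|q pE] := add_part_onto le_Km lt_jK _ pL; first by rewrite inE.
exists q => //; rewrite !inE; apply/andP; split.
  by have := add_part_partition le_Km lt_jK q; rewrite -pE !inE pn => <-.
by move: p_b; rewrite pE plength_add_part.
Qed.

End Count.

(** * The nonzero terms *)

Section NonzeroTerms.
Variables (f : fieldType) (char0 : [pchar f] =i pred0).
Variables (lam : f) (lam_neq0 : lam != 0).
Local Notation a := (-1 / lam).

Lemma falling_neq0 (b : f) l :
  (forall i, (i < l)%N -> b != i%:R) -> falling b l != 0.
Proof. by move=> b_neq; apply/prodf_neq0 => i _; rewrite subr_eq0 b_neq. Qed.

(** In characteristic 0, [n(n-1)...(n-l+1)] vanishes only through the factor
    [n - n]. *)
Lemma falling_nat_neq0 n l : (falling (n%:R : f) l != 0) = (l <= n)%N.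
Proof.
case: leqP => [le_ln|lt_nl]; last first.
  by rewrite /falling (bigD1 (Ordinal lt_nl)) //= subrr mul0r eqxx.
apply: falling_neq0 => i lt_il; have lt_in := leq_trans lt_il le_ln.
by rewrite -subr_eq0 -natrB 1?ltnW // natr_eq0 // subn_eq0 -ltnNge.
Qed.

Lemma pterm_neq0 m k (p : {ffun 'I_(m + k) -> 'I_(m + k).+1}) :
  (pterm lam p != 0) = (falling a (plength p) != 0).
Proof.
rewrite pterm_xmono scaler_eq0 /gmultinom mulf_eq0 invr_eq0 !negb_or.
have -> : \prod_i (p i)`!%:R != 0 :> f by apply/prodf_neq0 => i _; rewrite fact_neq0.
rewrite andbT mulf_neq0 ?andbT ?expf_neq0 ?xv_neq0 //.
by apply/prodf_neq0 => i _; rewrite expf_neq0 ?xv_neq0.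
Qed.

(** The falling factorial of a partition of length at most [k] involves only
    [a, a-1, ..., a-(k-1)], and [a] is nonzero. *)
Lemma nonzero_terms_generic m k : (0 < k)%N ->
  (forall n, (0 < n < k)%N -> a != n%:R) ->
  [set p in pindex m k | pterm lam p != 0] = pindex m k.
Proof.
move=> k_gt0 a_neq; apply/setP => p; rewrite inE andb_idr // => p_mk.
rewrite pterm_neq0; apply: falling_neq0 => -[|i] lt_i.
  by rewrite mulf_neq0 ?invr_eq0 // oppr_eq0 oner_eq0.
by rewrite a_neq //= (leq_trans lt_i) // pindex_plength.
Qed.

Lemma nonzero_terms_nat m k n : a = n%:R ->
  [set p in pindex m k | pterm lam p != 0] =
  [set p in pindex m k | (plength p <= n)%N].
Proof.
by move=> a_n; apply/setP => p; rewrite !inE pterm_neq0 a_n falling_nat_neq0.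
Qed.

Lemma card_pindex_large m K : (K <= m)%N ->
  #|pindex m K.+1| = (\sum_(j < K.+1) npart j)%N.
Proof.
move=> le_Km.
have -> : pindex m K.+1 = [set p in pindex m K.+1 | (plength p <= K.+1)%N].
  apply/setP => p; rewrite [RHS]inE andb_idr //; exact: pindex_plength.
rewrite card_pindex_plength //; apply: eq_bigr => j _; congr #|pred_of_set _|.
apply/setP => q; rewrite inE andb_idr // => /plength_le le_qj.
exact: leq_ltn_trans le_qj (ltn_ord j).
Qed.

Lemma card_pindex_bounded m K n : (K <= m)%N -> (0 < n)%N ->
  #|[set p in pindex m K.+1 | (plength p <= n)%N]| =
  (\sum_(j < K.+1) npart_le n.-1 j)%N.
Proof.
move=> le_Km n_gt0; rewrite card_pindex_plength //; apply: eq_bigr => j _.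
by rewrite -[in LHS](prednK n_gt0); under eq_finset do rewrite ltnS.
Qed.

End NonzeroTerms.

Theorem theorem6 (f : fieldType) (char0 : [pchar f] =i pred0)
    (lam : f) (lam_neq0 : lam != 0) :
  (exists P : forall m k : nat, {mpoly f[(m + k).+1]}, generated lam P) /\
  forall P : forall m k : nat, {mpoly f[(m + k).+1]}, generated lam P ->
  (* (1) *)
  (forall m k : nat, (0 < k)%N ->
     P m k \is k.-homog /\ P m k \is (m + k)%N.-homog for @wgt (m + k).+1) /\
  (* (2) *)
  (forall m k : nat, (0 < k)%N ->
     P m k = \sum_(p in pindex m k) pterm lam p) /\
  (* (3) *)
  (forall m k : nat, (0 < k)%N ->
     exists Q : {mpoly f[(m + k).+1]},
       is_line_integral (det_dx_A m k lam) Q /\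
       P m k = ((k.-1)`!%:R * (- lam) ^+ k)^-1 *: Q) /\
  (* (4) *)
  (forall k : nat, (0 < k)%N ->
     P 0%N k = (k`!%:R * (- lam) ^+ k)^-1
               *: \det (binom_mx (\row_(c < k) (c.+1%:R *: xv c.+1))
                                 (Amx lam k))) /\
  (* (5) *)
  (forall m k : nat, (0 < k)%N -> (k.-1 <= m)%N ->
     P m k = ((k.-1)`!%:R * (- lam) ^+ k)^-1
             *: \det (binom_mx (\row_(c < k) xv (m + c.+1)) (Amx lam k))) /\
  (* (6) *)
  (forall m : nat, P m 1%N = (- (1 / lam)) *: xv (m + 1)) /\
  (P 0%N 2%N = (- (1 / lam)) *: (xv 0 * xv 2)
             + ((lam + 1) / (2 * lam ^+ 2)) *: xv 1 ^+ 2) /\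
  (forall m : nat, (1 <= m)%N ->
     P m 2%N = (- (1 / lam)) *: (xv 0 * xv (m + 2))
             + ((lam + 1) / lam ^+ 2) *: (xv 1 * xv (m + 1))) /\
  (P 0%N 3%N = (- (1 / lam)) *: (xv 0 ^+ 2 * xv 3)
             + ((lam + 1) / lam ^+ 2) *: (xv 0 * xv 1 * xv 2)
             - ((lam + 1) * (2 * lam + 1) / (6 * lam ^+ 3)) *: xv 1 ^+ 3) /\
  (P 1%N 3%N = (- (1 / lam)) *: (xv 0 ^+ 2 * xv 4)
             + ((lam + 1) / (2 * lam ^+ 2))
                 *: (xv 0 * (2 * xv 1 * xv 3 + xv 2 ^+ 2))
             - ((lam + 1) * (2 * lam + 1) / (2 * lam ^+ 3))
                 *: (xv 1 ^+ 2 * xv 2)) /\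
  (forall m : nat, (2 <= m)%N ->
     P m 3%N = (- (1 / lam)) *: (xv 0 ^+ 2 * xv (m + 3))
             + ((lam + 1) / lam ^+ 2)
                 *: (xv 0 * (xv 1 * xv (m + 2) + xv 2 * xv (m + 1)))
             - ((lam + 1) * (2 * lam + 1) / (2 * lam ^+ 3))
                 *: (xv 1 ^+ 2 * xv (m + 1))) /\
  (P 0%N 4%N = (- (1 / lam)) *: (xv 0 ^+ 3 * xv 4)
             + ((lam + 1) / (2 * lam ^+ 2))
                 *: (xv 0 ^+ 2 * (2 * xv 1 * xv 3 + xv 2 ^+ 2))
             - ((lam + 1) * (2 * lam + 1) / (2 * lam ^+ 3))
                 *: (xv 0 * xv 1 ^+ 2 * xv 2)
             + ((lam + 1) * (2 * lam + 1) * (3 * lam + 1) / (24 * lam ^+ 4))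
                 *: xv 1 ^+ 4) /\
  (P 1%N 4%N = (- (1 / lam)) *: (xv 0 ^+ 3 * xv 5)
             + ((lam + 1) / lam ^+ 2)
                 *: (xv 0 ^+ 2 * (xv 1 * xv 4 + xv 2 * xv 3))
             - ((lam + 1) * (2 * lam + 1) / (2 * lam ^+ 3))
                 *: (xv 0 * (xv 1 ^+ 2 * xv 3 + xv 1 * xv 2 ^+ 2))
             + ((lam + 1) * (2 * lam + 1) * (3 * lam + 1) / (6 * lam ^+ 4))
                 *: (xv 1 ^+ 3 * xv 2)) /\
  (P 2%N 4%N = (- (1 / lam)) *: (xv 0 ^+ 3 * xv 6)
             + ((lam + 1) / (2 * lam ^+ 2))
                 *: (xv 0 ^+ 2
                     * (2 * xv 1 * xv 5 + 2 * xv 2 * xv 4 + xv 3 ^+ 2))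
             - ((lam + 1) * (2 * lam + 1) / (2 * lam ^+ 3))
                 *: (xv 0 * (xv 1 ^+ 2 * xv 4 + 2 * xv 1 * xv 2 * xv 3))
             + ((lam + 1) * (2 * lam + 1) * (3 * lam + 1) / (6 * lam ^+ 4))
                 *: (xv 1 ^+ 3 * xv 3)) /\
  (forall m : nat, (3 <= m)%N ->
     P m 4%N = (- (1 / lam)) *: (xv 0 ^+ 3 * xv (m + 4))
             + ((lam + 1) / lam ^+ 2)
                 *: (xv 0 ^+ 2 * (xv 1 * xv (m + 3) + xv 2 * xv (m + 2)
                                  + xv 3 * xv (m + 1)))
             - ((lam + 1) * (2 * lam + 1) / (2 * lam ^+ 3))
                 *: (xv 0 * (xv 1 ^+ 2 * xv (m + 2)
                             + 2 * xv 1 * xv 2 * xv (m + 1)))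
             + ((lam + 1) * (2 * lam + 1) * (3 * lam + 1) / (6 * lam ^+ 4))
                 *: (xv 1 ^+ 3 * xv (m + 1))) /\
  (* (7) *)
  (forall k : nat, (0 < k)%N ->
     (P 0%N k).@[fun=> 1] = (-1) ^+ k * gbinom (1 / lam) k) /\
  (forall m k : nat, (0 < k)%N -> (k.-1 <= m)%N ->
     (P m k).@[fun=> 1] = (-1) ^+ k / lam * gbinom (1 / lam) k.-1) /\
  (* (8) *)
  (forall k : nat, (0 < k)%N ->
     (forall n : nat, (0 < n < k)%N -> -1 / lam != n%:R) ->
     #|[set p in pindex 0 k | pterm lam p != 0]| = npart k /\
     (forall m : nat, (k.-1 <= m)%N ->
        #|[set p in pindex m k | pterm lam p != 0]|
        = (\sum_(j < k) npart j)%N)) /\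
  (forall k n : nat, (0 < n < k)%N -> -1 / lam = n%:R ->
     #|[set p in pindex 0 k | pterm lam p != 0]| = npart_le n k /\
     (* npart_le n.-1: with p_n instead, as printed in the source, the claim
        fails for every such k, n and m; see NOTES.md *)
     (forall m : nat, (k.-1 <= m)%N ->
        #|[set p in pindex m k | pterm lam p != 0]|
        = (\sum_(j < k) npart_le n.-1 j)%N)).
Proof.
split.
  exists (fun m k => partition_poly lam m k).
  by apply/(generatedP char0).
move=> P /(generatedP char0) PE.
have nlam : - lam != 0 by rewrite oppr_eq0.
have low : forall m k, P m k.+1 = partition_poly lam m k.+1 by move=> m k; apply: PE.
split=> [m k k_gt0|].
  by rewrite PE //; split; [apply: partition_poly_homog | apply: partition_poly_isobaric].
split=> [m k k_gt0|]; first by rewrite PE.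
split=> [m [//|K] _|].
  exists ((K`!%:R * (- lam) ^+ K.+1) *: partition_poly lam m K.+1).
  split; first exact: partition_poly_integral.
  by rewrite low scalerA mulVf ?scale1r ?det_norm_neq0.
split=> [[//|K] _|].
  rewrite low det_Amx_id // scalerA.
  have K1 : K.+1%:R != 0 :> f by rewrite natr_eq0.
  apply: (scalerI K1); rewrite partition_poly0_sum // scalerA.
  have -> : K.+1%:R * ((K.+1`!%:R * (- lam) ^+ K.+1)^-1 * (K`!%:R * (- lam) ^+ K)) =
      -1 / lam.
    rewrite factS natrM exprSr; field.
    by rewrite lam_neq0 nlam expf_neq0 // fact_neq0 // addrC natr1.
  by congr (_ *: _); apply: eq_bigr => c _; rewrite mxE.
split=> [m [//|K] _ le_Km|].
  rewrite low partition_poly_linear // det_Amx_id // scalerA.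
  congr (_ *: _); last by apply: eq_bigr => c _; rewrite mxE.
  rewrite exprSr; field.
  by rewrite lam_neq0 nlam expf_neq0 // fact_neq0.
have [e1 [e02 [e2 [e03 [e13 [e3 [e04 [e14 [e24 e4]]]]]]]]] := partition_poly_examples char0 lam_neq0.
split=> [m|]; first by rewrite low e1.
split; first by rewrite low e02.
split=> [m le_m|]; first by rewrite low e2.
split; first by rewrite low e03.
split; first by rewrite low e13.
split=> [m le_m|]; first by rewrite low e3.
split; first by rewrite low e04.
split; first by rewrite low e14.
split; first by rewrite low e24.
split=> [m le_m|]; first by rewrite low e4.
split=> [[//|K] _|]; first by rewrite low meval_partition_poly0.
split=> [m [//|K] _ le_Km|]; first by rewrite low meval_partition_poly_large.
split=> [k k_gt0 a_neq|k n /andP[n_gt0 lt_nk] a_n].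
  split=> [|m]; first by rewrite nonzero_terms_generic // pindex0.
  case: k k_gt0 a_neq => [//|K] _ a_neq le_Km.
  by rewrite nonzero_terms_generic // card_pindex_large.
rewrite (nonzero_terms_nat char0 _ _ a_n) pindex0 ?(leq_trans _ lt_nk) //.
split=> // m; case: k lt_nk => [//|K] _ le_Km.
by rewrite (nonzero_terms_nat char0 _ _ a_n) card_pindex_bounded.
Qed.
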